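(* Let $\alpha>0$ be a constant with $\alpha\neq 1$. For each $n$ (in an infinite set of positive integers, with $n\to\infty$) let $G=G^{(n)}$ be a $d$-regular graph on vertex set $\{1,\dots,n\}$, $d=d(n)$, and let $\lambda=\lambda(G)$ be the maximum absolute value of the eigenvalues $\lambda_2,\dots,\lambda_n$ of its adjacency matrix. Assume that $d\to\infty$ and $\lambda=o(d)$ as $n\to\infty$. Let $G_p$ be the random subgraph of $G$ obtained by keeping each edge of $G$ independently with probability $p=\frac{\alpha}{d}$. (a) If $\alpha<1$, then with high probability the maximum component size of $G_p$ is $O(\log n)$; that is, there is a constant $C>0$ such that with high probability every connected component of $G_p$ has at most $C\log n$ vertices. (b) If $\alpha>1$, then with high probability $G_p$ has a unique giant component, of asymptotic size $\left(1-\frac{\bar\alpha}{\alpha}\right)n$, and the remaining components are of size $O(\log n)$; that is, there is a constant $C>0$ such that with high probability $G_p$ has exactly one component with $(1+o(1))\left(1-\frac{\bar\alpha}{\alpha}\right)n$ vertices and every other component has at most $C\log n$ vertices.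
   Context: All graphs are simple. The eigenvalues $d=\lambda_1\ge\lambda_2\ge\cdots\ge\lambda_n$ of a $d$-regular graph $G$ on $n$ vertices are those of its adjacency matrix, and $\lambda(G)=\max_{2\le i\le n}|\lambda_i|$. The size of a component is its number of vertices. An event holds with high probability if its probability tends to $1$ as $n\to\infty$. For $\alpha>1$, $\bar\alpha<1$ denotes the unique solution other than $\alpha$ of the equation $xe^{-x}=\alpha e^{-\alpha}$. Asymptotic notation is as $n\to\infty$ with $\alpha$ fixed; $n$ is assumed as large as needed (in particular so that $p\le 1$). *)

(* Defs.v *)
From HB Require Import structures.
From mathcomp Require Import all_boot all_order all_algebra.
From mathcomp Require Import all_classical all_reals all_analysis.
Set Implicit Arguments.
Unset Strict Implicit.
Unset Printing Implicit Defensive.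
Import Order.TTheory GRing.Theory Num.Theory.
Import numFieldNormedType.Exports.
Local Open Scope ring_scope.

Section Graph.
Variable T : finType.
Implicit Types (e : rel T) (F : {set {set T}}).

Definition regular_graph e (d : nat) : Prop :=
  [/\ symmetric e, irreflexive e & forall x, #|[set y | e x y]| = d].

(* An edge is the unordered pair [set x; y]. *)
Definition edges e : {set {set T}} := [set [set u.1; u.2] | u in [pred u | e u.1 u.2]].

Definition components F : {set {set T}} :=
  equivalence_partition (connect [rel x y | [set x; y] \in F]) [set: T].

End Graph.

Section Eigenvalues.
Variables (R : realType) (n : nat).

Definition adjacency (e : rel 'I_n) : 'M[R]_n := \matrix_(i, j) (e i j)%:R.

(* The list lambda_1 >= ... >= lambda_n, with multiplicity. It is unique, and
   exists when A is symmetric; [::] is the junk value when the characteristic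
   polynomial of A does not split over R. *)
Definition eigenvalues (A : 'M[R]_n) : seq R :=
  xget [::]
    [set s | sorted >=%R s /\ char_poly A = \prod_(x <- s) ('X - x%:P)]%classic.

(* [behead] drops lambda_1. *)
Definition lambda (e : rel 'I_n) : R :=
  \big[Num.max/0]_(x <- behead (eigenvalues (adjacency e))) `|x|.

End Eigenvalues.

(* Probability that the random subset of E keeping each element independently
   with probability p has property A; meaningful for 0 <= p <= 1. *)
Definition random_subset_prob (R : realType) (S : finType) (E : {set S}) (p : R)
    (A : pred {set S}) : R :=
  \sum_(F in powerset E | A F) \prod_(s in E) (if s \in F then p else 1 - p).

(* P n is the probability of the n-th event; n tends to infinity inside N. *)
Definition whp (R : realType) (N : set nat) (P : nat -> R) : Prop :=
  (P n @[n --> within N \oo] --> (1 : R))%classic.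

(* For alpha > 1 there is exactly one such x, and 0 < x. *)
Definition conjugate_root (R : realType) (alpha : R) : R :=
  xget 0 [set x | [/\ x < 1, x != alpha &
                      x * expR (- x) = alpha * expR (- alpha)]]%classic.

(* Components of size (1 + delta) m with |delta| <= eps (for m >= 0). *)
Definition giants (R : realType) (n : nat) (F : {set {set 'I_n}}) (m eps : R) :
    {set {set 'I_n}} :=
  [set K in components F | `|#|K|%:R - m| <= eps * m].

(* Main.v *)
(* All estimates come from one change of measure. Explore the component C of a
   vertex v by querying, one at a time, the edges of G that leave the set reached so
   far. Comparing the edge probabilities p >= p', the likelihood ratio (p' over
   p) of a transcript is x^(|C|-1) y^m, where x = p'/p, y = (1-p')/(1-p), and the
   number m of negative answers lies between the number of edges of G leaving C and
   the number of edges touching C, hence equals (1 + o(1)) d |C| when C is small.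
   - p = 1/d, p' = alpha/d with alpha < 1: exponential tail for |C|.
   - p = alpha/d with alpha > 1, p' = 1/d: exponential tail for |C| restricted to
     |C| <= gamma n, where the expander mixing lemma bounds the boundary of C below.
   - p = alpha/d, p' = q alpha/d with q = exp(-alpha(1 - q)): the ratio is 1/q + o(1) for
     bounded |C|, and under the subcritical p' the size |C| has bounded moments, so
     P_p(|C| <= k) tends to q as n and then k tend to infinity.
   The Efron-Stein inequality concentrates the number of vertices in small components
   around q n. For uniqueness, write G_p as the union of G_p1, with p1 slightly
   smaller, and an independent sprinkling: by mixing, the sprinkled edges join all
   large components of G_p1, and too few vertices remain for a second large one. *)
Require Import Defs.
From HB Require Import structures.
From mathcomp Require Import all_boot all_order all_algebra.
From mathcomp Require Import all_classical all_reals all_analysis.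
From mathcomp Require Import complex spectral ring lra.
(* all_classical shadows the names of finite sets. *)
From mathcomp Require Import fintype finset.
Set Implicit Arguments.
Unset Strict Implicit.
Unset Printing Implicit Defensive.
Import Order.TTheory GRing.Theory Num.Theory.
Import numFieldNormedType.Exports.
Local Open Scope ring_scope.

(** * Spectral decomposition of real symmetric matrices *)

Lemma char_poly_conj (F : fieldType) n (P A : 'M[F]_n) :
  P \in unitmx -> char_poly (invmx P *m A *m P) = char_poly A.
Proof.
move=> Pu; pose f := @map_mx _ _ (@polyC F) n n.
have fK : f (invmx P) *m f P = 1%:M by rewrite -map_mxM mulVmx// map_mx1.
rewrite /char_poly; have -> : char_poly_mx (invmx P *m A *m P) =
    f (invmx P) *m char_poly_mx A *m f P.
  rewrite /char_poly_mx mulmxBr mulmxBl !map_mxM/=.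
  have eX : f (invmx P) *m 'X%:M *m f P = 'X%:M by rewrite scalar_mxC -mulmxA fK mulmx1.
  by rewrite eX.
by rewrite !det_mulmx mulrAC -det_mulmx fK det1 mul1r.
Qed.

Lemma char_poly_diag (F : comNzRingType) n (D : 'rV[F]_n) :
  char_poly (diag_mx D) = \prod_i ('X - (D 0 i)%:P).
Proof.
rewrite char_poly_trig ?diag_mx_is_trig//.
by apply: eq_bigr => i _; rewrite !mxE eqxx mulr1n.
Qed.

Section Spectral.
Variables (R : realType) (n : nat) (A : 'M[R]_n).
Hypothesis A_sym : A^T = A.
Local Notation C := R[i].
Local Notation toC := (real_complex R).
Local Notation "M ^t*" := (map_mx Num.conj M^T) (at level 30).

(** The spectral theorem is applied over [R[i]] to the image of [A], which is Hermitian. Its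
    eigenvalues are then real, and the factorization of the characteristic polynomial descends to
    [R] because the embedding of polynomials is injective. *)
Lemma symmetric_spectral : exists (P : 'M[C]_n) (mu : 'I_n -> R),
  [/\ P *m P^t* = 1%:M,
      map_mx toC A = P^t* *m diag_mx (\row_i toC (mu i)) *m P &
      char_poly A = \prod_i ('X - (mu i)%:P)].
Proof.
pose B := map_mx toC A.
have B_real : B \is a mxOver Num.real.
  by apply/mxOverP => i j; rewrite mxE; apply/complex_realP; exists (A i j).
have B_sym : B \is symmetricmx.
  by apply/is_hermitianmxP; rewrite expr0 scale1r map_mx_id// /B map_trmx A_sym.
have B_herm := realsym_hermsym B_sym B_real.
have /mxOverP D_real := hermitian_spectral_diag_real B_herm.
have /orthomx_spectralP B_eq := hermitian_normalmx B_herm.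
have PU := spectral_unitarymx B.
set P := spectralmx B in PU B_eq *; set D := spectral_diag B in D_real B_eq *.
have eD : D = \row_i toC (complex.Re (D 0 i)).
  by apply/rowP => i; rewrite mxE RRe_real.
exists P, (fun i => complex.Re (D 0 i)); split.
- exact/unitarymxP.
- by rewrite -eD -[LHS]/B {1}B_eq invmx_unitary.
- apply: (@map_poly_inj _ _ toC).
  rewrite map_char_poly -/B {1}B_eq char_poly_conj ?spectral_unit//.
  rewrite char_poly_diag rmorph_prod; apply: eq_bigr => i _.
  rewrite rmorphB /= map_polyX map_polyC/=; congr (_ - _%:P).
  by rewrite RRe_real.
Qed.

End Spectral.

(** * Spectral gap and the expander mixing lemma *)

Section Mixing.
Variables (R : realType) (n d : nat) (e : rel 'I_n).
Hypothesis e_reg : regular_graph e d.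
Local Notation A := (adjacency R e).
Local Notation C := R[i].
Local Notation toC := (real_complex R).
Local Notation "M ^t*" := (map_mx Num.conj M^T) (at level 30).

Lemma lambda_ge0 : 0 <= lambda R e.
Proof. by rewrite /lambda; elim/big_rec: _ => // x y _ y0; rewrite le_max y0 orbT. Qed.

Lemma le_lambda x : x \in behead (eigenvalues A) -> `|x| <= lambda R e.
Proof. by move=> xs; exact: (@le_bigmax_seq _ _ _ _ _ x xpredT (fun y => `|y|) xs). Qed.

Lemma adjacency_sym : A^T = A.
Proof. by case: e_reg => sym _ _; apply/matrixP => i j; rewrite !mxE sym. Qed.

Lemma adjacency_row i : \sum_j A i j = d%:R.
Proof.
case: e_reg => _ _ /(_ i) <-; rewrite -sum1_card natr_sum [RHS]big_mkcond/=.
by apply: eq_bigr => j _; rewrite mxE inE; case: (e i j).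
Qed.

(** Sorting [mu] gives a list with both required properties, so [eigenvalues] is not the junk value;
    uniqueness of the roots with multiplicity does the rest. *)
Lemma eigenvalues_perm (mu : 'I_n -> R) :
  char_poly A = \prod_i ('X - (mu i)%:P) ->
  perm_eq (eigenvalues A) [seq mu i | i <- enum 'I_n].
Proof.
move=> Amu; set s := [seq mu i | i <- enum 'I_n].
have sE : \prod_(x <- s) ('X - x%:P) = \prod_i ('X - (mu i)%:P).
  by rewrite /s big_map big_enum.
have /= : exists t, [set t | sorted >=%R t /\ char_poly A = \prod_(x <- t) ('X - x%:P)]%classic t.
  exists (sort >=%R s); split=> /=; first by apply: sort_sorted => x y; exact: le_total.
  by rewrite Amu -sE; apply: perm_big; rewrite perm_sym perm_sort.
move=> /(xgetPex [::]) [_]; rewrite -/(eigenvalues A) => Aeig.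
by apply: prod_XsubC_eq; rewrite -Aeig Amu sE.
Qed.

Section Diagonalized.
Variables (P : 'M[C]_n) (mu : 'I_n -> R).
Hypothesis PU : P *m P^t* = 1%:M.
Hypothesis AP : map_mx toC A = P^t* *m diag_mx (\row_i toC (mu i)) *m P.
Hypothesis Amu : char_poly A = \prod_i ('X - (mu i)%:P).

Let D : 'rV[C]_n := \row_i toC (mu i).
(** Coordinates of [f] in the orthonormal basis of eigenvectors formed by the rows of [P]. *)
Let z (f : 'rV[R]_n) : 'rV[C]_n := map_mx toC f *m P^t*.

Let PU' : P^t* *m P = 1%:M. Proof. exact: mulmx1C. Qed.

Let zA f : z (f *m A) = z f *m diag_mx D.
Proof. by rewrite /z map_mxM/= AP !mulmxA -!mulmxA PU mulmx1. Qed.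

(** Parseval's identity for the unitary [P]. *)
Let dotz (f g : 'rV[R]_n) :
  toC ((f *m g^T) 0 0) = \sum_i z f 0 i * (z g 0 i)^*.
Proof.
have -> : \sum_i z f 0 i * (z g 0 i)^* = (z f *m (z g)^t*) 0 0.
  by rewrite mxE; apply: eq_bigr => i _; rewrite !mxE.
have zt : (z g)^t* = P *m (map_mx toC g)^t*.
  rewrite /z trmx_mul map_mxM/=; congr (_ *m _).
  by apply/matrixP => i j; rewrite !mxE conjCK.
rewrite zt /z mulmxA -(mulmxA _ _ P).
rewrite PU' mulmx1 !mxE rmorph_sum; apply: eq_bigr => i _.
by rewrite !mxE rmorphM/=; congr (_ * _); rewrite conj_Creal//; apply/complex_realP; exists (g 0 i).
Qed.

(** Row [i] of [P] is an eigenvector: [A] multiplies its l1 norm by exactly [|mu i|], and by at most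
    [d], the common row sum. *)
Lemma eigenvalue_le_degree i : `|mu i| <= d%:R.
Proof.
have PA : P *m map_mx toC A = diag_mx D *m P by rewrite AP !mulmxA PU mul1mx.
have s0 : 0 < \sum_j `|P i j|.
  rewrite lt_def sumr_ge0 ?andbT//; apply/eqP => s0.
  have /matrixP/(_ i i) := PU; rewrite !mxE eqxx big1 => [/eqP|j _].
    by rewrite eq_sym oner_eq0.
  have /eqP : `|P i j| = 0 by apply: (psumr_eq0P _ s0).
  by rewrite normr_eq0 => /eqP->; rewrite mul0r.
rewrite -lecR -(ler_pM2r s0).
have -> : (`|mu i|%:C)%C = `|toC (mu i)| by rewrite normc_def /= expr0n addr0 sqrtr_sqr.
rewrite mulr_sumr.
have -> : \sum_j `|toC (mu i)| * `|P i j| = \sum_j `|(P *m map_mx toC A) i j|.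
  apply: eq_bigr => j _; rewrite -normrM PA mxE (bigD1 i)//= big1 ?addr0 ?mxE ?eqxx ?mulr1n//.
  by move=> k ki; rewrite !mxE eq_sym (negbTE ki) mulr0n mul0r.
apply: (@le_trans _ _ (\sum_j \sum_k `|P i k| * toC (A k j))).
  apply: ler_sum => j _; rewrite mxE; apply: le_trans (ler_norm_sum _ _ _) _.
  apply: ler_sum => k _; rewrite normrM ler_wpM2l// !mxE.
  by case: (e k j); rewrite ?normr0 ?normr1.
rewrite exchange_big/= mulr_sumr; apply: ler_sum => k _.
by rewrite -mulr_sumr -rmorph_sum adjacency_row mulrC.
Qed.

Let one : 'rV[R]_n := const_mx 1.

Let one_eigen i : z one 0 i != 0 -> mu i = d%:R.
Proof.
move=> z0; have oneA : one *m A = d%:R *: one.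
  apply/rowP => j; rewrite !mxE mulr1 -(adjacency_row j).
  apply: eq_bigr => k _; rewrite mxE mul1r.
  by rewrite -[in LHS]adjacency_sym mxE.
have := zA one; rewrite oneA => /rowP/(_ i).
rewrite {1}/z map_mxZ -scalemxAl -/(z one) mul_mx_diag [LHS]mxE [RHS]mxE [D 0 i]mxE mulrC.
by move=> /(mulfI z0)/complexI.
Qed.

(** In the eigenbasis the form is a sum of terms [mu i * |z f 0 i| ^+ 2], so it suffices that each
    coordinate vanishes or carries an eigenvalue bounded by [lambda]. The only exceptional direction
    is the all-ones vector, to which [f] is orthogonal. *)
Lemma quadratic_le_lambda (f : 'rV[R]_n) :
  \sum_i f 0 i = 0 ->
  `|(f *m A *m f^T) 0 0| <= lambda R e * (f *m f^T) 0 0.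
Proof.
move=> f0; suff zmu i : z f 0 i = 0 \/ `|mu i| <= lambda R e.
  rewrite -lecR rmorphM/= !dotz.
  have -> x : (`|x|%:C)%C = `|toC x| :> C by rewrite normc_def /= expr0n addr0 sqrtr_sqr.
  rewrite dotz zA mulr_sumr; apply: le_trans (ler_norm_sum _ _ _) _.
  apply: ler_sum => i _.
  have -> : (z f *m diag_mx D) 0 i = toC (mu i) * z f 0 i.
    by rewrite mul_mx_diag [LHS]mxE [D 0 i]mxE mulrC.
  rewrite -mulrA -normCK normrM.
  have [->|mui] := zmu i; first by rewrite normr0 expr0n/= normr0 !mulr0.
  rewrite [`|_ ^+ 2|]ger0_norm ?exprn_ge0// ler_wpM2r ?exprn_ge0//.
  by rewrite normc_def /= expr0n addr0 sqrtr_sqr lecR.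
have mulP := eigenvalues_perm Amu.
have [dl|ld] := leP d%:R (lambda R e).
  by right; exact: le_trans (eigenvalue_le_degree i) dl.
have n0 : one != 0.
  by apply/eqP => /rowP/(_ i); rewrite !mxE => /eqP; rewrite oner_eq0.
have [k zk] : exists k, z one 0 k != 0.
  apply/existsP; rewrite -negb_forall; apply: contra n0 => /forallP z0.
  have : map_mx toC one *m P^t* = 0.
    by apply/rowP => j; rewrite [RHS]mxE; apply/eqP; exact: z0.
  move=> /(congr1 (mulmx^~ P)); rewrite -mulmxA PU' mulmx1 mul0mx => /matrixP z1.
  apply/eqP/rowP => j; have := z1 0 j; rewrite !mxE; exact: complexI.
have muk := one_eigen zk.
(* Here [lambda < d], so [d] cannot occur after the head of the list: it is a simple eigenvalue. *)
have dS : d%:R \notin behead (eigenvalues A).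
  apply/negP => dS; move: ld; rewrite ltNge => /negP; apply.
  rewrite -[leLHS]ger0_norm ?ler0n//.
  exact: le_lambda.
have : perm_eq (eigenvalues A) (mu k :: [seq mu j | j <- rem k (enum 'I_n)]).
  apply: (perm_trans mulP); rewrite -map_cons perm_map// perm_to_rem//.
  by rewrite mem_enum.
case E : (eigenvalues A) => [|s0 s] sk; first by have := perm_size sk.
move: dS; rewrite E/= => dS.
have s0d : s0 = mu k.
  have : mu k \in s0 :: s by rewrite (perm_mem sk) mem_head.
  by rewrite inE => /orP[/eqP//|]; rewrite muk (negbTE dS).
move: sk; rewrite s0d perm_cons => sk.
have [->|ik] := eqVneq i k; last first.
  right; apply: le_lambda; rewrite E/=.
  rewrite (perm_mem sk) map_f// (rem_filter _ (enum_uniq _)) mem_filter/= ik.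
  by rewrite mem_enum.
(* Only coordinate [k] of the all-ones vector is nonzero, so orthogonality of [f] to it forces
   [z f 0 k = 0]. *)
left; have : toC ((f *m one^T) 0 0) = 0.
  rewrite (_ : _ 0 0 = 0) ?rmorph0// mxE -[RHS]f0.
  by apply: eq_bigr => j _; rewrite !mxE mulr1.
rewrite dotz (bigD1 k)//= big1 ?addr0; last first.
  move=> j jk; have [->|zj] := eqVneq (z one 0 j) 0; first by rewrite conjC0 mulr0.
  suff : d%:R \in s by rewrite (negbTE dS).
  rewrite -(one_eigen zj) (perm_mem sk) map_f// (rem_filter _ (enum_uniq _)).
  by rewrite mem_filter/= jk mem_enum.
by move/eqP; rewrite mulf_eq0 conjC_eq0 (negbTE zk) orbF => /eqP.
Qed.

End Diagonalized.

(** The quadratic form is tested on the indicator of [S] minus its mean [c], whose squared norm is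
    at most [|S|]. The sum counts every edge inside [S] twice. *)
Lemma mixing (S : {set 'I_n}) :
  `|(\sum_(i in S) #|[set j in S | e i j]|)%:R - d%:R * #|S|%:R ^+ 2 / n%:R|
    <= lambda R e * #|S|%:R.
Proof.
have [->|[x xS]] := set_0Vmem S.
  by rewrite big_set0 cards0 expr0n/= !mulr0 mul0r subrr normr0.
have n0 : (n%:R : R) != 0 by rewrite pnatr_eq0 -lt0n (leq_ltn_trans _ (ltn_ord x)).
have [P [mu [PU AP Amu]]] := symmetric_spectral adjacency_sym.
pose c : R := #|S|%:R / n%:R.
pose f : 'rV[R]_n := \row_i ((i \in S)%:R - c).
have sumS : \sum_i ((i \in S)%:R : R) = #|S|%:R by rewrite -natr_sum -sum1_card [in RHS]big_mkcond.
have f0 : \sum_i f 0 i = 0.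
  under eq_bigr => i _ do rewrite mxE.
  rewrite big_split/= sumS sumr_const cardT size_enum_ord /c -[_ *+ n]mulr_natr mulNr divfK//.
  by rewrite subrr.
have := quadratic_le_lambda PU AP Amu f0.
have -> : (f *m f^T) 0 0 = #|S|%:R - c * #|S|%:R.
  rewrite mxE; under eq_bigr => i _ do rewrite [f^T _ _]mxE {2}mxE mulrBr.
  rewrite sumrB -mulr_suml f0 mul0r subr0.
  transitivity (\sum_i (((i \in S)%:R : R) - c * (i \in S)%:R)).
    by apply: eq_bigr => i _; rewrite mxE; case: (i \in S) => /=; ring.
  by rewrite sumrB -mulr_sumr sumS.
have -> : (f *m A *m f^T) 0 0 =
    (\sum_(i in S) #|[set j in S | e i j]|)%:R - d%:R * #|S|%:R ^+ 2 / n%:R.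
  have fA j : (f *m A) 0 j = (\sum_i (i \in S)%:R * A i j) - c * d%:R.
    rewrite mxE; under eq_bigr => i _ do rewrite mxE mulrBl.
    rewrite sumrB; congr (_ - _); rewrite -mulr_sumr -(adjacency_row j); congr (_ * _).
    by case: e_reg => sym _ _; apply: eq_bigr => i _; rewrite !mxE sym.
  rewrite mxE (eq_bigr (fun j => (\sum_i (i \in S)%:R * A i j) * f 0 j -
    c * d%:R * f 0 j)); last first.
    by move=> j _; rewrite -mulrBl -fA [f^T _ _]mxE.
  rewrite sumrB -mulr_sumr f0 mulr0 subr0.
  rewrite (eq_bigr (fun j => (\sum_i (i \in S)%:R * A i j) * (j \in S)%:R -
    (\sum_i (i \in S)%:R * A i j) * c)); last first.
    by move=> j _; rewrite -mulrBr; congr (_ * _); rewrite mxE.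
  rewrite sumrB -mulr_suml; congr (_ - _).
    rewrite natr_sum [RHS]big_mkcond/=.
    rewrite (eq_bigr (fun j => \sum_i (i \in S)%:R * A i j * (j \in S)%:R)); last first.
      by move=> j _; rewrite mulr_suml.
    rewrite exchange_big/=; apply: eq_bigr => i _.
    case: (i \in S) => /=; last first.
      by under eq_bigr => j _ do rewrite !mul0r; rewrite sumr_const mul0rn.
    rewrite -sum1_card natr_sum [RHS]big_mkcond/=; apply: eq_bigr => j _.
    by rewrite inE !mxE mul1r; case: (j \in S); case: (e i j); rewrite /= ?mulr1 ?mulr0.
  rewrite exchange_big/= (eq_bigr (fun i => (i \in S)%:R * d%:R)); last first.
    by move=> i _; rewrite -mulr_sumr adjacency_row.
  by rewrite -mulr_suml sumS /c; field.
move=> /le_trans; apply; rewrite ler_wpM2l ?lambda_ge0//.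
by rewrite gerBl mulr_ge0// divr_ge0.
Qed.

End Mixing.

(** * Expectations over independent random subsets *)

Lemma ler_bool (R : numDomainType) (b c : bool) : (b -> c) -> b%:R <= c%:R :> R.
Proof. by case: b c => [] [] // /(_ isT). Qed.

Section RandomSubset.
Variables (R : realType) (S : finType).
Implicit Types (E F B : {set S}) (p : R) (f g : {set S} -> R).

Definition Ex E p f : R :=
  \sum_(F in powerset E) (\prod_(s in E) (if s \in F then p else 1 - p)) * f F.

Lemma random_subset_probE E p (A : pred {set S}) :
  random_subset_prob E p A = Ex E p (fun F => (A F)%:R).
Proof.
rewrite /random_subset_prob /Ex big_mkcondr; apply: eq_bigr => F _.
by case: (A F); rewrite ?mulr1 ?mulr0.
Qed.

Lemma eq_Ex E p f g : (forall F, F \subset E -> f F = g F) -> Ex E p f = Ex E p g.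
Proof. by move=> fg; apply: eq_bigr => F; rewrite powersetE => /fg ->. Qed.

Lemma Ex_set0 p f : Ex set0 p f = f set0.
Proof. by rewrite /Ex powerset0 big_set1 big_set0 mul1r. Qed.

(** Conditioning on whether the single element [s] is kept; the inductions on [E] below rest on this
    recursion. *)
Lemma Ex_D1 E p f s : s \in E ->
  Ex E p f = p * Ex (E :\ s) p (fun F => f (s |: F)) + (1 - p) * Ex (E :\ s) p f.
Proof.
move=> sE; rewrite /Ex !mulr_sumr (bigID (fun F : {set S} => s \in F))/=; congr (_ + _).
  rewrite (reindex_onto (fun F => s |: F) (fun F => F :\ s)) /=; last first.
    by move=> F /andP[_ sF]; rewrite setD1K.
  apply: eq_big => [F|F].
    rewrite !powersetE subUset sub1set sE setU11 /= andbT subsetD1.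
    have [sF|sF] := boolP (s \in F); last by rewrite andbT setU1K ?eqxx// andbT.
    rewrite !andbF; apply/negbTE; rewrite negb_and orbC.
    by apply/orP; left; apply/eqP => /setP/(_ s); rewrite !inE eqxx sF.
  move=> /andP[_ /eqP sF]; rewrite (big_setD1 s)//= setU11 mulrA; congr (_ * _ * _).
  by apply: eq_bigr => t; rewrite !inE => /andP[/negbTE -> _].
apply: eq_big => [F|F /andP[_ sF]]; first by rewrite !powersetE subsetD1.
by rewrite (big_setD1 s)//= (negbTE sF) mulrA.
Qed.

Lemma set_ind (P : {set S} -> Prop) :
  P set0 -> (forall E s, s \in E -> P (E :\ s) -> P E) -> forall E, P E.
Proof.
move=> P0 PS E; have [m] := ubnP #|E|; elim: m E => // m IHm E Em.
have [->//|[s sE]] := set_0Vmem E; apply: (PS _ _ sE); apply: IHm.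
by move: Em; rewrite (cardsD1 s E) sE.
Qed.

Lemma ExD E p f g : Ex E p (fun F => f F + g F) = Ex E p f + Ex E p g.
Proof. by rewrite /Ex -big_split; apply: eq_bigr => F _; rewrite mulrDr. Qed.

Lemma ExZ E p c f : Ex E p (fun F => c * f F) = c * Ex E p f.
Proof. by rewrite /Ex mulr_sumr; apply: eq_bigr => F _; rewrite mulrCA. Qed.

Lemma ExB E p f g : Ex E p (fun F => f F - g F) = Ex E p f - Ex E p g.
Proof.
by rewrite -mulN1r -ExZ -ExD; apply: eq_Ex => F _; rewrite mulN1r.
Qed.

Lemma Ex_cst E p c : Ex E p (fun _ => c) = c.
Proof.
elim/set_ind: E => [|E s sE IH]; first by rewrite Ex_set0.
by rewrite (Ex_D1 _ _ sE) !IH; ring.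
Qed.

Lemma Ex_sum (I : finType) E p (f : I -> {set S} -> R) :
  Ex E p (fun F => \sum_i f i F) = \sum_i Ex E p (f i).
Proof.
by rewrite /Ex exchange_big; apply: eq_bigr => F _; rewrite mulr_sumr.
Qed.

Section Monotone.
Variable p : R.
Hypotheses (p_ge0 : 0 <= p) (p_le1 : p <= 1).

Lemma le_Ex E f g : (forall F, F \subset E -> f F <= g F) -> Ex E p f <= Ex E p g.
Proof.
move=> fg; apply: ler_sum => F; rewrite powersetE => FE.
by rewrite ler_wpM2l ?fg// prodr_ge0// => s _; case: ifP; rewrite ?subr_ge0.
Qed.

Lemma Ex_ge0 E f : (forall F, F \subset E -> 0 <= f F) -> 0 <= Ex E p f.
Proof. by move=> f0; rewrite -(Ex_cst E p 0); exact: le_Ex. Qed.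

Lemma Ex_markov E f (t : R) : 0 < t -> (forall F, F \subset E -> 0 <= f F) ->
  Ex E p (fun F => (t <= f F)%R%:R) <= Ex E p f / t.
Proof.
move=> t0 f0; rewrite mulrC -ExZ; apply: le_Ex => F FE.
have [tf|_] := lerP t (f F); first by rewrite ler_pdivlMl ?mulr1.
by rewrite mulr_ge0 ?f0// invr_ge0 ltW.
Qed.

(* Efron-Stein, with the factor 1 - p in the variance of a single coordinate bounded by 1. *)
Lemma Ex_variance E f (L : R) :
  (forall s F, s \in E -> F \subset E :\ s -> `|f (s |: F) - f F| <= L) ->
  Ex E p (fun F => f F ^+ 2) - Ex E p f ^+ 2 <= #|E|%:R * (p * L ^+ 2).
Proof.
elim/set_ind: E f => [|E s sE IH] f fL; first by rewrite !Ex_set0 subrr cards0 mul0r.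
rewrite !(Ex_D1 _ _ sE) (cardsD1 s) sE add1n -natr1.
set f1 := fun F => f (s |: F).
set a := Ex _ _ f1; set b := Ex _ _ f.
set a2 := Ex _ _ (fun F => f1 F ^+ 2); set b2 := Ex _ _ (fun F => f F ^+ 2).
have h1 : a2 - a ^+ 2 <= #|E :\ s|%:R * (p * L ^+ 2).
  apply: IH => t F /setD1P[ts tE] FE; rewrite /f1 setUCA; apply: fL => //.
  rewrite subUset sub1set !inE eq_sym ts sE/=.
  apply/fintype.subsetP => x /(fintype.subsetP FE); rewrite !inE.
  by move=> /and3P[-> _ ->].
have h2 : b2 - b ^+ 2 <= #|E :\ s|%:R * (p * L ^+ 2).
  apply: IH => t F /setD1P[ts tE] FE; apply: fL => //.
  by apply: (subset_trans FE); rewrite setSD// subsetDl.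
have ab : `|a - b| <= L.
  rewrite -ExB ler_norml -{1}(Ex_cst (E :\ s) p (- L)) -{2}(Ex_cst (E :\ s) p L).
  by apply/andP; split; apply: le_Ex => F FE; have := fL s F sE FE;
    rewrite ler_norml => /andP[].
have ab2 : (a - b) ^+ 2 <= L ^+ 2.
  by rewrite -real_normK ?num_real// lerXn2r// nnegrE (le_trans _ ab).
have p1 : 0 <= 1 - p by rewrite subr_ge0.
(* Total variance for the coordinate [s]: the average of the two conditional variances plus
   [p * (1 - p) * (a - b) ^+ 2]. *)
have h3 : p * ((1 - p) * (a - b) ^+ 2) <= p * L ^+ 2.
  rewrite ler_wpM2l// (le_trans _ ab2)// ler_piMl ?sqr_ge0// lerBlDr lerDl//.
move: (ler_wpM2l p_ge0 h1) (ler_wpM2l p1 h2) h3.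
move: (p * L ^+ 2) => c'.
by move: #|_|%:R a b a2 b2 {h1 h2 ab ab2} => m a b a2 b2; lra.
Qed.

Lemma Ex_chebyshev E f (L t : R) : 0 < t ->
  (forall s F, s \in E -> F \subset E :\ s -> `|f (s |: F) - f F| <= L) ->
  Ex E p (fun F => (t <= `|f F - Ex E p f|)%R%:R) <= #|E|%:R * (p * L ^+ 2) / t ^+ 2.
Proof.
move=> t0 fL; set m := Ex E p f.
apply: (@le_trans _ _ (Ex E p (fun F => (t ^+ 2 <= (f F - m) ^+ 2)%R%:R))).
  apply: le_Ex => F _; apply: ler_bool => tf.
  by rewrite -[X in _ <= X]real_normK ?num_real// lerXn2r// nnegrE ltW.
apply: le_trans (Ex_markov _ _) _; rewrite ?exprn_gt0//.
  by move=> F _; exact: sqr_ge0.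
rewrite ler_wpM2r ?invr_ge0 ?exprn_ge0 ?(ltW t0)//.
apply: le_trans (Ex_variance fL); rewrite -/m.
rewrite (_ : Ex _ _ _ = Ex E p (fun F => f F ^+ 2 - 2 * m * f F + m ^+ 2)).
  by rewrite ExD ExB ExZ Ex_cst -/m; lra.
by apply: eq_Ex => F _; ring.
Qed.

End Monotone.

(** Two-round exposure: an element is missed by both independent rounds with probability
    [(1 - p1) * (1 - p2)]. *)
Lemma Ex_setU E p p1 p2 f : 1 - p = (1 - p1) * (1 - p2) ->
  Ex E p f = Ex E p1 (fun F1 => Ex E p2 (fun F2 => f (F1 :|: F2))).
Proof.
move=> pE; elim/set_ind: E f => [|E s sE IH] f; first by rewrite !Ex_set0 setU0.
rewrite (Ex_D1 p f sE) (Ex_D1 p1 _ sE) !IH.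
have eU F1 F2 : s |: F1 :|: (s |: F2) = s |: (F1 :|: F2).
  by rewrite -setUA (setUCA F1) setUA setUid.
rewrite [X in _ = p1 * X + _](@eq_Ex _ _ _ (fun F1 =>
   Ex (E :\ s) p2 (fun F2 => f (s |: (F1 :|: F2))))); last first.
  move=> F1 _; rewrite (Ex_D1 p2 _ sE).
  under eq_Ex => F2 _ do rewrite eU.
  under [X in _ + _ * X]eq_Ex => F2 _ do rewrite -setUA.
  by ring.
rewrite [X in _ = _ + (1 - p1) * X](@eq_Ex _ _ _ (fun F1 =>
   p2 * Ex (E :\ s) p2 (fun F2 => f (s |: (F1 :|: F2))) +
   (1 - p2) * Ex (E :\ s) p2 (fun F2 => f (F1 :|: F2)))); last first.
  move=> F1 _; rewrite (Ex_D1 p2 _ sE).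
  by under eq_Ex => F2 _ do rewrite setUCA.
rewrite ExD !ExZ pE (_ : p = 1 - (1 - p1) * (1 - p2)); last by rewrite -pE; ring.
by ring.
Qed.

Lemma Ex_disjoint E B p : B \subset E ->
  Ex E p (fun F => [disjoint F & B]%:R) = (1 - p) ^+ #|B|.
Proof.
elim/set_ind: E B => [|E s sE IH] B BE.
  by move: BE; rewrite subset0 => /eqP->; rewrite Ex_set0 cards0 expr0 -setI_eq0 setI0 eqxx.
rewrite (Ex_D1 _ _ sE); have [sB|sB] := boolP (s \in B).
  rewrite [X in p * X](@eq_Ex _ _ _ (fun=> 0)) ?Ex_cst ?mulr0 ?add0r; last first.
    move=> F _; case: (boolP [disjoint _ & _]) => // /pred0P/(_ s).
    by rewrite /= setU11 sB.
  rewrite (cardsD1 s B) sB exprS -IH ?setSD//; congr (_ * _).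
  apply: eq_Ex => F; rewrite subsetD1 => /andP[_ sF].
  rewrite -!setI_eq0; congr (_ == _)%:R; apply/setP => x; rewrite !inE.
  by case: eqVneq => // ->; rewrite (negbTE sF).
have BE' : B \subset E :\ s by rewrite subsetD1 BE.
rewrite -(IH _ BE').
rewrite [X in p * X](@eq_Ex _ _ _ (fun F => [disjoint F & B]%:R)).
  by rewrite -mulrDl addrC subrK mul1r.
move=> F _; rewrite -!setI_eq0; congr (_ == _)%:R; apply/setP => x; rewrite !inE.
by case: eqVneq => // ->; rewrite (negbTE sB) !andbF.
Qed.

End RandomSubset.

(** * Exploration of a component and change of measure *)

Section Reach.
Variable T : finType.
Implicit Types (E F : {set {set T}}) (A B X : {set T}).

Definition adj F : rel T := [rel x y | [set x; y] \in F].

(** The start is a set, not a single vertex, so that the exploration can absorb each vertex it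
    discovers. *)
Definition reach F A : {set T} := [set w | [exists a in A, connect (adj F) a w]].

Lemma adj_connect_sym F : connect_sym (adj F).
Proof. by apply: sym_connect_sym => x y; rewrite /adj/= setUC. Qed.

Lemma sub_reach F A : A \subset reach F A.
Proof.
by apply/subsetP => x xA; rewrite inE; apply/existsP; exists x; rewrite xA connect0.
Qed.

Lemma reach_closed F A x y : x \in reach F A -> [set x; y] \in F -> y \in reach F A.
Proof.
rewrite !inE => /existsP[a /andP[aA ax]] xy; apply/existsP; exists a.
by rewrite aA (connect_trans ax)// connect1.
Qed.

Lemma reach_min F A B : A \subset B ->
  (forall x y, x \in B -> [set x; y] \in F -> y \in B) -> reach F A \subset B.
Proof.
move=> AB Bcl; apply/subsetP => w; rewrite inE => /existsP[a /andP[/(subsetP AB) aB]].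
move=> /connectP[s + ->]; elim: s a aB => //= y s IHs a aB /andP[/(Bcl _ _ aB) yB].
exact: IHs.
Qed.

Lemma reachU1 F A a w : a \in A -> reach ([set a; w] |: F) A = reach F (w |: A).
Proof.
move=> aA; apply/eqP; rewrite eqEsubset; apply/andP; split.
  have wAR := sub_reach F (w |: A).
  apply: reach_min => [|x y xR]; first exact: subset_trans (subsetUr _ _) wAR.
  rewrite in_setU1 => /orP[/eqP xy|]; last exact: reach_closed.
  have : y \in [set a; w] by rewrite -xy set22.
  by rewrite in_set2 => /orP[]/eqP->; apply: (subsetP wAR); rewrite ?setU11// setU1r.
apply: reach_min => [|x y xR xy]; last by apply: reach_closed xR _; rewrite setU1r.
rewrite subUset sub_reach sub1set andbT.
by apply: reach_closed (subsetP (sub_reach _ _) _ aA) _; rewrite setU11.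
Qed.

Lemma reach_id E F A : (forall a w, a \in A -> w \notin A -> [set a; w] \notin E) ->
  F \subset E -> reach F A = A.
Proof.
move=> AE /subsetP FE; apply/eqP; rewrite eqEsubset sub_reach andbT.
by apply: reach_min => // x y xA /FE; apply: contraLR; exact: AE.
Qed.

(** When the exploration stops at [X], the edges it has queried contain [boundary E X] and lie in
    [touching E X]. *)
Definition boundary E X : {set {set T}} :=
  [set f in E | [exists a in X, exists w, (w \notin X) && (f == [set a; w])]].

Definition touching E X : {set {set T}} := [set f in E | ~~ [disjoint f & X]].

Lemma boundaryD1 E X f : boundary (E :\ f) X = boundary E X :\ f.
Proof. by apply/setP => g; rewrite !inE andbA. Qed.

Lemma touchingD1 E X f : touching (E :\ f) X = touching E X :\ f.
Proof. by apply/setP => g; rewrite !inE andbA. Qed.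

Lemma boundary_inner E X a w : a \in X -> w \in X -> [set a; w] \notin boundary E X.
Proof.
move=> aX wX; rewrite inE negb_and; apply/orP; right.
apply/negP => /existsP[b /andP[_ /existsP[z /andP[zX /eqP awbz]]]].
have : z \in [set a; w] by rewrite awbz set22.
by rewrite in_set2 => /orP[]/eqP zE; rewrite zE ?aX ?wX in zX.
Qed.

Section Tilting.
Variables (R : realType) (p q x y : R).
Hypotheses (p01 : 0 <= p <= 1) (q01 : 0 <= q <= 1) (x_ge0 : 0 <= x) (y_ge1 : 1 <= y).
Hypotheses (xp : x * p = q) (yp : y * (1 - p) = 1 - q).

Lemma crossing_edge E A : (exists a w, [/\ a \in A, w \notin A & [set a; w] \in E]) \/
  forall a w, a \in A -> w \notin A -> [set a; w] \notin E.
Proof.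
have [/existsP[a /existsP[w /and3P[aA wA awE]]]|cr] :=
    boolP [exists a, exists w, [&& a \in A, w \notin A & [set a; w] \in E]].
  by left; exists a, w.
right=> a w aA wA; apply: contra cr => awE; apply/existsP; exists a.
by apply/existsP; exists w; rewrite aA wA.
Qed.

(* Revealing the edges crossing the current set one at a time: a present edge
   costs a factor x, an absent one a factor y. Every boundary edge of the final
   set is revealed, and every revealed edge touches it. *)
Lemma tilt_boundary E A (g : {set T} -> R) : (forall X, 0 <= g X) ->
  Ex E p (fun F => g (reach F A) *
    (x ^+ #|reach F A :\: A| * y ^+ #|boundary E (reach F A)|))
  <= Ex E q (fun F => g (reach F A)).
Proof.
move=> g0; case/andP: p01 => p0 p1; case/andP: q01 => q0 q1.
have y0 : 0 <= y := le_trans ler01 y_ge1.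
have [m] := ubnP #|E|; elim: m E A => // m IHm E A Em.
have [[a [w [aA wA awE]]]|nE] := crossing_edge E A; last first.
  rewrite (@eq_Ex _ _ _ _ _ (fun=> g A)) ?Ex_cst; last first.
    move=> F FE; rewrite (reach_id nE)// setDv cards0 (_ : boundary E A = set0).
      by rewrite cards0 mulr1 mulr1.
    apply/setP => f; rewrite !inE; apply/negP => /andP[fE].
    move=> /existsP[a /andP[aA /existsP[w /andP[wA /eqP fE']]]].
    by have := nE _ _ aA wA; rewrite -fE' fE.
  rewrite (@eq_Ex _ _ _ _ _ (fun=> g A)) ?Ex_cst// => F FE.
  by rewrite (reach_id nE).
have Em' : (#|E :\ [set a; w]| < m)%N by move: Em; rewrite (cardsD1 [set a; w]) awE.
rewrite (Ex_D1 _ _ awE) [leRHS](Ex_D1 _ _ awE); apply: lerD.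
  (* Present edge: [w] joins the starting set and pays one factor [x]; the edge is then internal,
     hence never in the boundary. *)
  rewrite -{1}xp [leRHS](_ : _ = p * (x * Ex (E :\ [set a; w]) q
    (fun F => g (reach F (w |: A))))); last first.
    rewrite mulrA [p * x]mulrC; congr (_ * _).
    by apply: eq_Ex => F _; rewrite reachU1.
  rewrite ler_wpM2l//; apply: le_trans (ler_wpM2l x_ge0 (IHm _ _ Em')).
  rewrite -ExZ; apply: le_Ex => // F _; rewrite reachU1//.
  have /subsetP wAR := sub_reach F (w |: A).
  have aR : a \in reach F (w |: A) by rewrite wAR// setU1r.
  have wR : w \in reach F (w |: A) by rewrite wAR// setU11.
  rewrite [leRHS]mulrCA ler_wpM2l// mulrA -exprS boundaryD1.
  rewrite (cardsD1 [set a; w] (boundary E _)) (negbTE (boundary_inner _ aR wR)).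
  rewrite (cardsD1 w (_ :\: A)) in_setD wA wR.
  by rewrite (_ : _ :\: A :\ w = reach F (w |: A) :\: (w |: A)) // setDDl setUC.
(* Absent edge: one factor [y]. The edge may or may not lie in the final boundary, and [y >= 1]
   covers both cases. *)
rewrite -yp [y * _]mulrC -mulrA ler_wpM2l ?subr_ge0//.
apply: le_trans (ler_wpM2l y0 (IHm _ _ Em')).
rewrite -ExZ; apply: le_Ex => // F _; rewrite [leRHS]mulrCA ler_wpM2l//.
rewrite [leRHS]mulrCA ler_wpM2l ?exprn_ge0// -exprS ler_weXn2l//.
by rewrite boundaryD1 (cardsD1 [set a; w] (boundary E _)); case: (_ \in _).
Qed.

(** The same exploration with the opposite inequality: every revealed edge touches the final set, so
    the exponent of [y] counts all absent answers, and [y >= 1] makes the surplus factors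
    harmless. *)
Lemma tilt_touching E A (g : {set T} -> R) : (forall X, 0 <= g X) ->
  Ex E q (fun F => g (reach F A)) <=
  Ex E p (fun F => g (reach F A) *
    (x ^+ #|reach F A :\: A| * y ^+ #|touching E (reach F A)|)).
Proof.
move=> g0; case/andP: p01 => p0 p1; case/andP: q01 => q0 q1.
have y0 : 0 <= y := le_trans ler01 y_ge1.
have [m] := ubnP #|E|; elim: m E A => // m IHm E A Em.
have [[a [w [aA wA awE]]]|nE] := crossing_edge E A; last first.
  rewrite -[leLHS](@eq_Ex _ _ _ _ (fun=> g A)) ?Ex_cst; last first.
    by move=> F FE; rewrite (reach_id nE).
  rewrite -(Ex_cst E p (g A)); apply: le_Ex => // F FE; rewrite (reach_id nE)//.
  by rewrite setDv cards0 mul1r ler_peMr// exprn_ege1.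
have Em' : (#|E :\ [set a; w]| < m)%N by move: Em; rewrite (cardsD1 [set a; w]) awE.
have awT F B : a \in B ->
    #|touching E (reach F B)| = #|touching (E :\ [set a; w]) (reach F B)|.+1.
  move=> /(subsetP (sub_reach F B)) aR; rewrite touchingD1 (cardsD1 [set a; w] (touching E _)).
  rewrite inE awE (_ : ~~ _)//; apply/pred0Pn; exists a.
  by rewrite /= set21.
rewrite (Ex_D1 _ _ awE) [leRHS](Ex_D1 _ _ awE); apply: lerD.
  rewrite -{1}xp [leLHS](_ : _ = p * (x * Ex (E :\ [set a; w]) q
    (fun F => g (reach F (w |: A))))); last first.
    rewrite mulrA [p * x]mulrC; congr (_ * _).
    by apply: eq_Ex => F _; rewrite reachU1.
  rewrite ler_wpM2l//; apply: le_trans (ler_wpM2l x_ge0 (IHm _ _ Em')) _.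
  rewrite -ExZ; apply: le_Ex => // F _; rewrite reachU1//.
  have /subsetP wAR := sub_reach F (w |: A).
  have wR : w \in reach F (w |: A) by rewrite wAR// setU11.
  rewrite mulrCA ler_wpM2l// mulrA -exprS.
  rewrite (cardsD1 w (_ :\: A)) in_setD wA wR awT ?setU1r//.
  rewrite (_ : _ :\: A :\ w = reach F (w |: A) :\: (w |: A)); last by rewrite setDDl setUC.
  by rewrite ler_wpM2l ?exprn_ge0// exprS ler_peMl// exprn_ge0.
rewrite -yp [y * _]mulrC -mulrA ler_wpM2l ?subr_ge0//.
apply: le_trans (ler_wpM2l y0 (IHm _ _ Em')) _.
rewrite -ExZ; apply: le_Ex => // F _; rewrite mulrCA ler_wpM2l//.
by rewrite awT// exprS mulrCA.
Qed.

End Tilting.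

End Reach.

(** * Edge counts in a regular graph *)

Section EdgeCounts.
Variables (T : finType) (e : rel T) (d : nat).
Hypothesis e_reg : regular_graph e d.
Implicit Types (X : {set T}) (F : {set {set T}}).

Lemma edgesP f : reflect (exists x y, e x y /\ f = [set x; y]) (f \in edges e).
Proof.
apply: (iffP imsetP) => [[[x y] /= xy ->]|[x [y [xy ->]]]]; first by exists x, y.
by exists (x, y).
Qed.

Lemma card_pairs X (P : rel T) :
  #|[set u : T * T | (u.1 \in X) && P u.1 u.2]| = \sum_(a in X) #|[set w | P a w]|.
Proof.
rewrite -sum1_card (eq_bigr (fun a => \sum_(w | P a w) 1)); last first.
  by move=> a _; rewrite -sum1_card; apply: eq_bigl => w; rewrite inE.
by rewrite pair_big_dep; apply: eq_bigl => u; rewrite inE.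
Qed.

(** Each edge touching [X] comes from an ordered pair whose first entry is in [X], and there are
    [d * |X|] such pairs. *)
Lemma card_touching X : (#|touching (edges e) X| <= d * #|X|)%N.
Proof.
case: e_reg => sym _ deg.
have -> : (d * #|X| = #|[set u : T * T | (u.1 \in X) && e u.1 u.2]|)%N.
  rewrite card_pairs (eq_bigr (fun=> d)) => [|a _]; last exact: deg.
  by rewrite sum_nat_const mulnC.
apply: leq_trans (leq_imset_card (fun u => [set u.1; u.2]) _).
apply/subset_leq_card/subsetP => f; rewrite inE => /andP[/edgesP[x [y [xy ->]]]].
case/pred0Pn => z /= /andP[]; rewrite in_set2 => /orP[]/eqP-> zX.
  by apply/imsetP; exists (x, y); rewrite // inE zX.
by apply/imsetP; exists (y, x); rewrite /= ?inE/= ?zX ?(sym y)// setUC.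
Qed.

(** The ordered adjacent pairs starting in [X] either end in [X], and are counted by the sum, or
    leave [X], and then map injectively to boundary edges. *)
Lemma card_boundary X :
  (d * #|X| <= #|boundary (edges e) X| + \sum_(a in X) #|[set w in X | e a w]|)%N.
Proof.
case: e_reg => sym _ deg.
have -> : (d * #|X| = \sum_(a in X) (#|[set w in ~: X | e a w]| + #|[set w in X | e a w]|))%N.
  rewrite mulnC -sum_nat_const; apply: eq_bigr => a _; rewrite -(deg a) addnC.
  rewrite -(cardsID X); congr (_ + _)%N; apply: eq_card => w; rewrite !inE andbC//.
rewrite big_split leq_add2r/= -(card_pairs X (fun a w => (w \in ~: X) && e a w)).
rewrite -(@card_in_imset _ _ (fun u => [set u.1; u.2])); last first.
  move=> [a w] [a' w']; rewrite !inE/= => /and3P[aX wX _] /and3P[a'X w'X _] eq.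
  have : a \in [set a'; w'] by rewrite -eq set21.
  have : w \in [set a'; w'] by rewrite -eq set22.
  rewrite !in_set2 => /orP[]/eqP wE /orP[]/eqP aE; move: aX wX a'X w'X.
  - by rewrite wE aE => ->.
  - by rewrite wE aE => ? /negbTE->.
  - by rewrite wE aE.
  - by rewrite wE aE => ->.
apply/subset_leq_card/subsetP => f /imsetP[[a w]]; rewrite inE/= => /and3P[aX wX aw] ->.
rewrite inE; apply/andP; split; first by apply/edgesP; exists a, w.
apply/existsP; exists a; rewrite aX; apply/existsP; exists w.
by rewrite eqxx andbT; rewrite inE in wX.
Qed.

Lemma card_edges : (#|edges e| <= d * #|T|)%N.
Proof.
rewrite -cardsT; apply: leq_trans _ (card_touching [set: T]).
apply/subset_leq_card/subsetP => f fE; rewrite inE fE /=.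
have /edgesP[x [y [_ ->]]] := fE.
by apply/pred0Pn; exists x; rewrite /= set21 inE.
Qed.

End EdgeCounts.

(** * Change of measure between two edge rates *)

Section Tilt.
Variables (R : realType) (T : finType) (e : rel T) (d : nat).
Hypothesis e_reg : regular_graph e d.
Implicit Types (a b : R) (g : {set T} -> R).

Definition component (F : {set {set T}}) v := reach F [set v].
Local Notation E := (edges e).

Lemma odds_ratio_ge (p q : R) : 0 <= q -> q <= p -> p < 1 ->
  expR (p - q) <= (1 - q) / (1 - p).
Proof.
move=> q0 qp p1; have q1 : 0 < 1 - q by lra. have p1' : 0 < 1 - p by lra.
rewrite -[leRHS]invrK invf_div -[p - q]opprK expRN lef_pV2 ?posrE ?expR_gt0 ?divr_gt0//.
apply: le_trans (expR_ge1Dx _); rewrite ler_pdivrMr//.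
by nra.
Qed.

Lemma odds_ratio_le (p q : R) : 0 <= q -> q <= p -> p < 1 ->
  (1 - q) / (1 - p) <= expR ((p - q) / (1 - p)).
Proof.
move=> q0 qp p1; have p1' : 1 - p != 0 by rewrite subr_eq0 gt_eqF.
rewrite (_ : (1 - q) / (1 - p) = 1 + (p - q) / (1 - p)); last by field.
exact: expR_ge1Dx.
Qed.

(** The starting vertex [v] pays no factor in the exploration; the extra [b / a] makes the exponent
    the full component size. *)
Lemma tilt_size_factor a b F v : 0 < a -> 0 < b ->
  b / a * (b / a) ^+ #|component F v :\: [set v]| = expR (- (ln (a / b) * #|component F v|%:R)).
Proof.
move=> a0 b0; have vF : v \in component F v by rewrite (subsetP (sub_reach _ _))// inE.
rewrite -exprS (_ : _.+1 = #|component F v|); last by rewrite [RHS](cardsD1 v) vF.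
by rewrite -mulNr expRM_natr expRN lnK ?posrE ?divr_gt0// invf_div.
Qed.

Section Rates.
Variables a b : R.
Hypotheses (b_gt0 : 0 < b) (b_le_a : b <= a) (a_lt_d : a < d%:R).
Let a0 : 0 < a. Proof. exact: lt_le_trans b_gt0 b_le_a. Qed.
Let d0 : 0 < d%:R :> R. Proof. exact: lt_trans a0 a_lt_d. Qed.
Let p := a / d%:R.
Let q := b / d%:R.
Let q0 : 0 <= q. Proof. by rewrite divr_ge0// ltW. Qed.
Let qp : q <= p. Proof. by rewrite ler_wpM2r// invr_ge0 ltW. Qed.
Let p1 : p < 1. Proof. by rewrite ltr_pdivrMr// mul1r. Qed.
Let x := b / a.
Let y := (1 - q) / (1 - p).
Let p01 : 0 <= p <= 1. Proof. by rewrite (le_trans q0 qp) ltW. Qed.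
Let q01 : 0 <= q <= 1. Proof. by rewrite q0 (le_trans qp) ?ltW. Qed.
Let x0 : 0 <= x. Proof. by rewrite divr_ge0// ltW. Qed.
Let y1 : 1 <= y.
Proof. by rewrite ler_pdivlMr ?subr_gt0// mul1r lerD2l lerN2. Qed.
Let xp : x * p = q.
Proof. by rewrite /x /p /q mulrA divfK// gt_eqF. Qed.
Let yp : y * (1 - p) = 1 - q.
Proof. by rewrite /y divfK// gt_eqF// subr_gt0. Qed.

(** The exploration is tilted with [x = b / a] and [y >= expR ((a - b) / d)], raised to the boundary
    size. *)
Lemma component_tilt_le v g : (forall X, 0 <= g X) ->
  Ex E p (fun F => g (component F v) *
    expR ((a - b) / d%:R * #|boundary E (component F v)|%:R - ln (a / b) * #|component F v|%:R))
  <= b / a * Ex E q (fun F => g (component F v)).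
Proof.
move=> g0; have ba0 : 0 < b / a by rewrite divr_gt0.
have := ler_wpM2l (ltW ba0) (tilt_boundary p01 q01 x0 y1 xp yp E [set v] g0).
apply: le_trans; rewrite -ExZ; case/andP: p01 => p0 p1'.
apply: le_Ex => // F _; rewrite mulrCA ler_wpM2l// -/(component F v) mulrA.
rewrite /x tilt_size_factor// expRD mulrC ler_wpM2l ?expR_ge0// expRM_natr.
rewrite lerXn2r ?nnegrE ?expR_ge0 ?(le_trans ler01)// mulrBl.
exact: odds_ratio_ge.
Qed.

(** Here [y ^+ d] is at most [expR ((a - b) / (1 - a / d))], and at most [d] edges per vertex touch
    the component. *)
Lemma component_tilt_ge v g : (forall X, 0 <= g X) ->
  Ex E q (fun F => g (component F v)) <= a / b * Ex E p (fun F => g (component F v) *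
    expR (((a - b) / (1 - a / d%:R) - ln (a / b)) * #|component F v|%:R)).
Proof.
move=> g0; apply: le_trans (tilt_touching p01 q01 x0 y1 xp yp E [set v] g0) _.
rewrite -ExZ; case/andP: p01 => p0 p1'.
apply: le_Ex => // F _; rewrite [leRHS]mulrCA ler_wpM2l// -/(component F v).
have abx : a / b * x = 1 by rewrite /x; field; rewrite !gt_eqF.
rewrite -[leLHS]mul1r -{1}abx.
rewrite -mulrA ler_wpM2l ?(ltW (divr_gt0 _ _))// mulrA tilt_size_factor//.
rewrite (mulrBl #|component F v|%:R) expRD mulrC ler_wpM2r ?expR_ge0//.
apply: le_trans (_ : y ^+ (d * #|component F v|) <= _); first by rewrite ler_weXn2l// card_touching.
rewrite [in leRHS]expRM_natr exprM lerXn2r ?nnegrE ?exprn_ge0 ?expR_ge0 ?(le_trans ler01)//.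
apply: le_trans (_ : expR ((p - q) / (1 - p)) ^+ d <= _).
  by rewrite lerXn2r ?nnegrE ?expR_ge0 ?(le_trans ler01)// odds_ratio_le.
rewrite -expRM_natr -/p mulrAC /p /q -mulrBl divfK// gt_eqF//.
Qed.

End Rates.
End Tilt.

(** * Exponential moments of component sizes *)

Section Asymptotically.
Variable R : realType.

(* "For all regular graphs with d large enough and lambda / d small enough"; both
   requirements are governed by the single threshold D. *)
Definition asymptotically (P : forall n : nat, nat -> rel 'I_n -> Prop) : Prop :=
  exists D : nat, forall n d (e : rel 'I_n), regular_graph e d -> (0 < n)%N ->
    (D <= d)%N -> lambda R e * D%:R <= d%:R -> P n d e.

Lemma asymptotically_and P Q : asymptotically P -> asymptotically Q ->
  asymptotically (fun n d e => P n d e /\ Q n d e).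
Proof.
move=> [D1 h1] [D2 h2]; exists (maxn D1 D2) => n d e er n0.
rewrite geq_max => /andP[d1 d2] le; split; [apply: h1|apply: h2] => //;
  by apply: le_trans le; rewrite ler_wpM2l ?lambda_ge0// ler_nat ?leq_maxl ?leq_maxr.
Qed.

Lemma regular_degree_lt n d (e : rel 'I_n) : regular_graph e d -> (0 < n)%N -> (d < n)%N.
Proof.
case=> _ irr deg; case: n e irr deg => // n e irr /(_ ord0) <- _.
rewrite -[X in (_ < X)%N](card_ord n.+1) -cardsT; apply: proper_card.
by apply/properP; split; [exact: subsetT|exists ord0; rewrite !inE// irr].
Qed.

Lemma asymptotically_imp P Q : asymptotically P ->
  (forall n d (e : rel 'I_n), regular_graph e d -> (d < n)%N -> P n d e -> Q n d e) ->
  asymptotically Q.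
Proof.
move=> [D h] PQ; exists D => n d e er n0 Dd le; apply: PQ => //; last exact: h.
exact: regular_degree_lt er n0.
Qed.

Lemma asymptotically_degree (M : R) : asymptotically (fun n d e => M <= d%:R).
Proof.
exists (Num.truncn M).+1 => n d e _ _ Dd _; apply: le_trans (_ : (Num.truncn M).+1%:R <= _).
  by rewrite ltW// truncnS_gt.
by rewrite ler_nat.
Qed.

Lemma asymptotically_lambda (c : R) : 0 < c ->
  asymptotically (fun n d e => lambda R e <= c * d%:R).
Proof.
move=> c0; exists (Num.truncn c^-1).+1 => n d e _ _ _ le.
rewrite -ler_pdivrMl//; apply: le_trans le; rewrite mulrC ler_wpM2l ?lambda_ge0//.
by rewrite ltW// truncnS_gt.
Qed.

Lemma ln_ltB1 (a : R) : 0 < a -> a != 1 -> ln a < a - 1.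
Proof.
move=> a0 a1; have := @expR_gt1Dx R (ln a).
rewrite ln_eq0// => /(_ a1); rewrite lnK ?posrE//; lra.
Qed.

Lemma boundary_mixing n d (e : rel 'I_n) (X : {set 'I_n}) : regular_graph e d ->
  d%:R * #|X|%:R - d%:R * #|X|%:R ^+ 2 / n%:R - lambda R e * #|X|%:R
    <= #|boundary (edges e) X|%:R :> R.
Proof.
move=> er; have := card_boundary er X; have := mixing R er X.
rewrite -(ler_nat R) natrD natrM ler_norml => /andP[_]; lra.
Qed.

(** Tilt from the critical rate 1 to [a]. The exponent per vertex tends to [1 - a + ln a], which is
    negative; [c] is half its absolute value, and the other half absorbs the error from
    [1 - 1 / d]. *)
Lemma subcritical_moment (a : R) : 0 < a -> a < 1 -> exists2 c : R, 0 < c &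
  asymptotically (fun n d e => forall v,
    Ex (edges e) (a / d%:R) (fun F => expR (c * #|component F v|%:R)) <= a^-1).
Proof.
move=> a0 a1; have lna := ln_ltB1 a0 (negbT (lt_eqF a1)).
pose c := (a - 1 - ln a) / 2; have c0 : 0 < c by rewrite /c; lra.
exists c => //; have := asymptotically_degree ((1 - a + c) / c + 1 + 1).
move=> /asymptotically_imp; apply => n d e er _ dM v.
have d1 : 1 < d%:R :> R.
  apply: lt_le_trans dM; rewrite ltrDr addr_gt0// divr_gt0//; lra.
have d0 : 0 < d%:R :> R by apply: lt_trans d1.
have c1 : (1 - a) / (1 - 1 / d%:R) <= 1 - a + c.
  rewrite ler_pdivrMr; last by rewrite subr_gt0 ltr_pdivrMr// mul1r.
  rewrite mulrBr mulr1 mul1r -subr_ge0.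
  suff : (1 - a + c) / d%:R <= c by lra.
  rewrite ler_pdivrMr// mulrC -ler_pdivrMr//; lra.
pose G (X : {set 'I_n}) : R := expR (c * #|X|%:R).
have G0 X : 0 <= G X by exact: expR_ge0.
apply: le_trans (component_tilt_ge er a0 (ltW a1) d1 v G0) _.
have p0 : 0 <= 1 / d%:R :> R by rewrite divr_ge0.
have p1 : 1 / d%:R <= 1 :> R by rewrite ler_pdivrMr// mul1r ltW.
rewrite mul1r ler_piMr ?invr_ge0 ?(ltW a0)// -[leRHS](Ex_cst (edges e) (1 / d%:R)).
apply: le_Ex => // F _; rewrite /G -expRD expR_le1 -mulrDl mulr_le0_ge0//.
rewrite lnV ?posrE//; move: c1; rewrite /c; lra.
Qed.

(** Tilt from [a] to the critical rate 1. For size at most [g * n] and [lambda <= g * d], mixing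
    gives at least [(1 - 2 * g) * d] boundary edges per vertex; with the chosen [g] the exponent
    [(a - 1) * (1 - 2 * g) - ln a] equals [D / 2]. *)
Lemma supercritical_moment (a : R) : 1 < a -> exists c g : R, [/\ 0 < c, 0 < g &
  asymptotically (fun n d e => forall v,
    Ex (edges e) (a / d%:R) (fun F => (#|component F v|%:R <= g * n%:R)%R%:R *
       expR (c * #|component F v|%:R)) <= 1)].
Proof.
move=> a1; have a0 : 0 < a := lt_trans ltr01 a1.
have lna := ln_ltB1 a0 (negbT (gt_eqF a1)).
pose D := a - 1 - ln a; have D0 : 0 < D by rewrite /D; lra.
have a10 : 0 < a - 1 by rewrite subr_gt0.
pose g := D / (4 * (a - 1)); have g0 : 0 < g by rewrite divr_gt0// mulr_gt0.
exists (D / 2), g; split=> //; first by rewrite divr_gt0.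
have := asymptotically_and (asymptotically_degree (a + 1)) (asymptotically_lambda g0).
move=> /asymptotically_imp; apply => n d e er dn [da lg] v.
have ad : a < d%:R by lra.
have d0 : 0 < d%:R :> R by apply: lt_trans ad.
have n0 : 0 < n%:R :> R by rewrite ltr0n (leq_ltn_trans _ dn).
have p0 : 0 <= a / d%:R by rewrite divr_ge0// ltW.
have p1 : a / d%:R <= 1 by rewrite ler_pdivrMr// mul1r ltW.
have q0 : 0 <= 1 / d%:R :> R by rewrite divr_ge0.
have q1 : 1 / d%:R <= 1 :> R by rewrite ler_pdivrMr// mul1r; lra.
pose G (X : {set 'I_n}) : R := (#|X|%:R <= g * n%:R)%R%:R.
have G0 X : 0 <= G X by exact: ler0n.
have := component_tilt_le e ltr01 (ltW a1) ad v G0; rewrite divr1.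
move=> tilt; apply: (@le_trans _ _ (1 / a * 1)); last first.
  by rewrite mulr1 ler_pdivrMr// mul1r ltW.
apply: le_trans (_ : 1 / a * Ex (edges e) (1 / d%:R) (fun F => G (component F v)) <= _); last first.
  rewrite ler_wpM2l ?divr_ge0 ?(ltW a0)// -[leRHS](Ex_cst (edges e) (1 / d%:R)).
  by apply: le_Ex => // F _; rewrite /G lern1 leq_b1.
apply: le_trans tilt; apply: le_Ex => // F _; rewrite -/(G _) /G.
set X := component F v; have [Xg|_] := lerP #|X|%:R (g * n%:R); last by rewrite !mul0r.
rewrite !mul1r ler_expR; have bX := boundary_mixing X er.
have X0 : 0 <= #|X|%:R :> R by [].
move: #|X|%:R #|boundary (edges e) X|%:R Xg bX X0 => x bx xg bX x0.
have bx' : (1 - 2 * g) * x <= bx / d%:R.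
  rewrite ler_pdivlMr//; apply: le_trans bX.
  have : d%:R * x ^+ 2 / n%:R <= d%:R * x * g.
    by rewrite expr2 mulrA -[leLHS]mulrA ler_wpM2l ?mulr_ge0 ?(ltW d0)// ler_pdivrMr.
  have := ler_wpM2r x0 lg; lra.
have := ler_wpM2l (ltW a10) bx'.
have gE : (a - 1) * g = D / 4 by rewrite /g; field; rewrite gt_eqF.
have -> : (a - 1) * ((1 - 2 * g) * x) = (a - 1 - 2 * ((a - 1) * g)) * x by ring.
rewrite gE /D mulrA [_ * bx]mulrC mulrA; lra.
Qed.

End Asymptotically.

(** * Small components and tail bounds *)

Section Components.
Variable T : finType.
Implicit Types (F : {set {set T}}).

Lemma mem_component F v w : (w \in component F v) = connect (adj F) v w.
Proof.
rewrite inE; apply/existsP/idP => [[a /andP[]]|vw]; first by rewrite inE => /eqP->.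
by exists v; rewrite inE eqxx.
Qed.

Lemma component_refl F v : v \in component F v.
Proof. by rewrite mem_component connect0. Qed.

Lemma component_eq F v w : w \in component F v -> component F w = component F v.
Proof.
rewrite mem_component => vw; apply/setP => z; rewrite !mem_component.
by rewrite (same_connect (adj_connect_sym F) vw).
Qed.

Lemma component_sub F1 F2 v : F1 \subset F2 -> component F1 v \subset component F2 v.
Proof.
move=> /subsetP F12; apply: reach_min => [|x y xC /F12]; first exact: sub_reach.
exact: reach_closed.
Qed.

Lemma component_setU1 F a w v : a \notin component F v -> w \notin component F v ->
  component ([set a; w] |: F) v = component F v.
Proof.
move=> aC wC; apply/eqP; rewrite eqEsubset [X in _ && X]component_sub ?subsetUr// andbT.
apply: reach_min => [|x y xC]; first exact: sub_reach.
rewrite in_setU1 => /orP[/eqP xy|]; last exact: reach_closed.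
have : x \in [set a; w] by rewrite -xy set21.
by rewrite in_set2 => /orP[]/eqP xE; rewrite xE ?(negbTE aC) ?(negbTE wC) in xC.
Qed.

Variable R : realType.
Implicit Type t : R.

Definition small F t : {set T} := [set v | #|component F v|%:R <= t].

Lemma in_small F t v : (v \in small F t) = (#|component F v|%:R <= t).
Proof. by rewrite inE. Qed.

(** A new edge changes only the components of its two endpoints, so the vertices that stop being
    small lie in at most two old components of size at most [k]. *)
Lemma small_setU1 F a w k :
  `|#|small ([set a; w] |: F) k%:R|%:R - #|small F k%:R|%:R| <= (2 * k)%:R :> R.
Proof.
have sub : small ([set a; w] |: F) k%:R \subset small F k%:R.
  apply/subsetP => v; rewrite !inE; apply: le_trans; rewrite ler_nat.
  by apply/subset_leq_card/component_sub/subsetUr.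
rewrite distrC ger0_norm ?subr_ge0 ?ler_nat ?subset_leq_card//.
rewrite lerBlDr -natrD ler_nat -(cardsID (small ([set a; w] |: F) k%:R)) (setIidPr sub) addnC.
rewrite leq_add2r; pose S x : {set T} := if (#|component F x| <= k)%N then component F x else set0.
apply: leq_trans (_ : #|S a :|: S w| <= _)%N; last first.
  apply: leq_trans (leq_card_setU _ _) _; rewrite mul2n -addnn.
  by rewrite /S; apply: leq_add; case: ifP => //; rewrite cards0.
apply/subset_leq_card/subsetP => v; rewrite in_setD in_setU !in_small !ler_nat.
move=> /andP[vk' vk]; have [aC|aC] := boolP (a \in component F v).
  by rewrite /S (component_eq aC) vk component_refl.
have [wC|wC] := boolP (w \in component F v).
  by rewrite /S (component_eq wC) vk component_refl orbT.
by rewrite component_setU1// vk in vk'.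
Qed.

(** Exponential Markov inequality, restricted to components satisfying [Q]. *)
Lemma small_tail (E : {set {set T}}) (p c K t : R) (Q : pred {set T}) v :
  0 <= p <= 1 -> 0 <= c ->
  Ex E p (fun F => (Q (component F v))%:R * expR (c * #|component F v|%:R)) <= K ->
  Ex E p (fun F => (Q (component F v) && (t < #|component F v|%:R)%R)%:R) <= K * expR (- (c * t)).
Proof.
move=> /andP[p0 p1] c0 /(ler_wpM2r (expR_ge0 (- (c * t)))); apply: le_trans.
rewrite mulrC -ExZ; apply: le_Ex => // F _; rewrite mulrCA.
case: (Q _); rewrite ?mul0r//= !mul1r -expRD.
have [tC|_] := ltrP t #|component F v|%:R; last exact: expR_ge0.
apply: le_trans (expR_ge1Dx _); rewrite lerDl addrC -mulrBr mulr_ge0// subr_ge0 ltW//.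
Qed.

End Components.

(** Union bound over the [n] vertices: at size [2 / c * ln n] each tail is at most [K / n ^+ 2]. *)
Lemma no_medium_component (R : realType) n (E : {set {set 'I_n}}) (p c K : R)
    (Q : pred {set 'I_n}) :
  (0 < n)%N -> 0 <= p <= 1 -> 0 < c ->
  (forall v, Ex E p (fun F => (Q (component F v))%:R * expR (c * #|component F v|%:R)) <= K) ->
  Ex E p (fun F => [exists v, Q (component F v) && (2 / c * ln n%:R < #|component F v|%:R)%R]%:R)
    <= K / n%:R.
Proof.
move=> n0 p01 c0 QK; have [p0 p1] := andP p01.
have n0' : 0 < n%:R :> R by rewrite ltr0n.
apply: (@le_trans _ _ (\sum_(v < n) K * expR (- (c * (2 / c * ln n%:R))))).
  apply: (@le_trans _ _ (\sum_(v < n) Ex E p (fun F =>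
      (Q (component F v) && (2 / c * ln n%:R < #|component F v|%:R)%R)%:R))); last first.
    by apply: ler_sum => v _; exact: (small_tail _ p01 (ltW c0) (QK v)).
  rewrite -Ex_sum; apply: le_Ex => // F _.
  case: existsP => [[v vP]|_]; last by apply: sumr_ge0.
  by rewrite (bigD1 v)//= vP lerDl; apply: sumr_ge0.
rewrite sumr_const card_ord (_ : c * _ = ln n%:R * 2%:R); last first.
  by field; rewrite gt_eqF.
rewrite expRN expRM_natr lnK ?posrE// -[_ *+ n]mulr_natr expr2 invfM mulrA divfK ?gt_eqF//.
Qed.

(** * Concentration and the limit law of a component size *)

Section LocalLimit.
Variables (R : realType) (a q : R).
Hypotheses (a_gt0 : 0 < a) (q_gt0 : 0 < q) (q_lt1 : q < 1).

(** Chebyshev with increments [2 * k] and at most [d * n] edges: the variance is at most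
    [a * (2 * k) ^+ 2 * n]. Since [d < n], a threshold on the degree also forces [n] to be large. *)
Lemma small_concentrated (eta : R) k : 0 < eta ->
  asymptotically R (fun n d e =>
    let p := a / d%:R in
    let mean := Ex (edges e) p (fun F => #|small F (k%:R : R)|%:R) in
    Ex (edges e) p (fun F => (eta * n%:R <= `|#|small F (k%:R : R)|%:R - mean|)%R%:R) <= eta).
Proof.
move=> eta0.
have := asymptotically_degree (a * (2 * k)%:R ^+ 2 / eta ^+ 3 + a + 1).
move=> /asymptotically_imp; apply => n d e er dn dM /=.
have M0 : 0 <= a * (2 * k)%:R ^+ 2 / eta ^+ 3.
  by rewrite divr_ge0 ?mulr_ge0 ?exprn_ge0 ?(ltW eta0) ?(ltW a_gt0).
have ad : a < d%:R by lra.
have d0 : 0 < d%:R :> R by apply: lt_trans ad.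
have dn' : d%:R < n%:R :> R by rewrite ltr_nat.
have n0 : 0 < n%:R :> R by lra.
have p0 : 0 <= a / d%:R by rewrite divr_ge0// ltW.
have p1 : a / d%:R <= 1 by rewrite ler_pdivrMr// mul1r ltW.
apply: le_trans (Ex_chebyshev p0 p1 (L := (2 * k)%:R) _ _) _; first by rewrite mulr_gt0.
  move=> s F /edgesP[x [y [_ ->]]] _; exact: small_setU1.
have := card_edges er; rewrite card_ord -(ler_nat R) natrM => Ec.
have L0 : 0 <= (2 * k)%:R ^+ 2 :> R by rewrite exprn_ge0.
move: (2 * k)%:R M0 dM L0 => L M0 dM L0.
rewrite ler_pdivrMr ?exprn_gt0 ?mulr_gt0//.
apply: le_trans (_ : d%:R * n%:R * (a / d%:R * L ^+ 2) <= _).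
  by rewrite ler_wpM2r// mulr_ge0.
rewrite (_ : d%:R * _ * _ = (a * L ^+ 2 / eta ^+ 3) * (eta ^+ 3 * n%:R)); last first.
  by field; rewrite !gt_eqF.
rewrite (_ : eta * (eta * n%:R) ^+ 2 = n%:R * (eta ^+ 3 * n%:R)); last by ring.
apply: ler_wpM2r; first by rewrite mulr_ge0 ?exprn_ge0// ltW.
by move: (a * L ^+ 2 / eta ^+ 3) dM (a_gt0) => Z dM; lra.
Qed.

Hypotheses (qE : q = expR (- (a * (1 - q)))) (aq_lt1 : a * q < 1).

(** [q] is the extinction probability of the Poisson branching process of mean [a], and [b = a * q]
    is the dual subcritical rate. By [qE], [ln (a / b) = a - b], so for components of bounded size
    the per-vertex exponents of the tilt cancel up to [O(1 / d)] and only the factor [b / a = q]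
    survives. *)
Lemma component_law_limit (eta : R) : 0 < eta -> exists k0 : nat, forall k, (k0 <= k)%N ->
  asymptotically R (fun n d e => forall v,
    `|Ex (edges e) (a / d%:R) (fun F => (#|component F v|%:R <= (k%:R : R))%R%:R) - q| <= eta).
Proof.
move=> eta0; pose b := a * q; have b0 : 0 < b by rewrite mulr_gt0.
have ba : b < a by rewrite /b gtr_pMr.
have lnab : ln (a / b) = a - b.
  rewrite /b invfM mulrA divff ?gt_eqF// mul1r lnV ?posrE// {1}qE expRK; ring.
have [c c0 cP] := subcritical_moment b0 aq_lt1.
(* Such a [k] brings the tail bound at rate [b] below [eta / 2], by [expR x >= 1 + x]. *)
exists (Num.truncn (2 * (b^-1 / (c * eta)))).+1 => k k0k.
have kc : b^-1 * expR (- (c * k%:R)) <= eta / 2.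
  have : 2 * (b^-1 / (c * eta)) <= k%:R.
    by apply: le_trans (ltW (truncnS_gt _)) _; rewrite ler_nat.
  rewrite mulrA ler_pdivrMr ?mulr_gt0// => kl.
  have := expR_ge1Dx (c * k%:R); rewrite expRN ler_pdivrMr ?expR_gt0// => ek.
  apply: le_trans (ler_wpM2l _ ek); last by rewrite divr_ge0// ltW.
  by nra.
(* [s0 / (d - a)] bounds both tilting errors: the at most [k ^+ 2] ordered pairs inside the
   component, and the replacement of [1 / (1 - a / d)] by 1. *)
pose s0 := (a - b) * k%:R * (k%:R + a).
have ab0 : 0 <= a - b by rewrite subr_ge0 ltW.
have s00 : 0 <= s0 by apply: mulr_ge0; [exact: mulr_ge0|rewrite addr_ge0// ltW].
(* The bound [s * s1 <= 1] yields [s <= 1] and [s <= eta / 2] at once. *)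
pose s1 := 1 + 2 / eta.
have := asymptotically_and cP (asymptotically_degree (a + 1 + s0 * s1)).
move=> /asymptotically_imp; apply => n d e er dn [{}cP dM] v.
have s10 : 0 < s1 by rewrite addr_gt0// divr_gt0.
have s010 := mulr_ge0 s00 (ltW s10).
have ad : a < d%:R by lra.
have d0 : 0 < d%:R :> R by apply: lt_trans ad.
have p0 : 0 <= a / d%:R by rewrite divr_ge0// ltW.
have p1 : a / d%:R <= 1 by rewrite ler_pdivrMr// mul1r ltW.
have q0 : 0 <= b / d%:R by rewrite divr_ge0// ltW.
have q1 : b / d%:R <= 1 by rewrite ler_pdivrMr// mul1r ltW// (lt_trans ba).
pose s := s0 / (d%:R - a).
have da0 : 0 < d%:R - a by rewrite subr_gt0.
have s_ge0 : 0 <= s by rewrite divr_ge0// ltW.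
have sl : s * s1 <= 1 by rewrite /s mulrAC ler_pdivrMr//; lra.
have s_le1 : s <= 1.
  by apply: le_trans sl; rewrite ler_peMr// /s1 lerDl divr_ge0// ltW.
have s_eta : s <= eta / 2.
  have : s * (2 / eta) <= 1.
    by apply: le_trans sl; rewrite ler_wpM2l// /s1 lerDr.
  by rewrite mulrA ler_pdivrMr// mul1r; lra.
pose G (X : {set 'I_n}) : R := (#|X|%:R <= (k%:R : R))%R%:R.
have G0 X : 0 <= G X by exact: ler0n.
set P := Ex _ _ _.
have P0 : 0 <= P by apply: Ex_ge0.
have P1 : P <= 1.
  rewrite -(Ex_cst (edges e) (a / d%:R) 1); apply: le_Ex => // F _.
  by rewrite lern1 leq_b1.
have upper : P * (1 - s) <= q.
  have := component_tilt_le e b0 (ltW ba) ad v G0.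
  have -> : b / a = q by rewrite /b mulrAC divff ?mul1r// gt_eqF.
  move=> tilt; apply: le_trans (le_trans tilt _); last first.
    rewrite ler_piMr ?(ltW q_gt0)// -[leRHS](Ex_cst (edges e) (b / d%:R)).
    by apply: le_Ex => // F _; rewrite /G lern1 leq_b1.
  rewrite mulrC -ExZ; apply: le_Ex => // F _; rewrite /G [leLHS]mulrC.
  have [Ck|_] := lerP #|component F v|%:R (k%:R : R); last by rewrite !mul0r.
  rewrite !mul1r; apply: le_trans (expR_ge1Dx _); rewrite lerD2l lnab.
  have := card_boundary er (component F v).
  have : (\sum_(i in component F v) #|[set w in component F v | e i w]|
          <= #|component F v| * #|component F v|)%N.
    rewrite -sum_nat_const; apply: leq_sum => i _.
    by apply/subset_leq_card/subsetP => w; rewrite inE => /andP[].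
  rewrite -!(ler_nat R) natrD !natrM; move: Ck.
  move: #|component F v|%:R (ler0n R #|component F v|) #|boundary _ _|%:R => x x0 bd xk h1 h2.
  have xx : x * x <= k%:R * k%:R by rewrite ler_pM.
  have bd' : x - x * x / d%:R <= bd / d%:R.
    by rewrite ler_pdivlMr// mulrBl divfK ?gt_eqF//; lra.
  have := ler_wpM2l (_ : 0 <= a - b) bd'; rewrite subr_ge0 (ltW ba) => /(_ isT) h3.
  have : (a - b) * (x * x / d%:R) <= s.
    rewrite /s /s0 mulrA ler_pdivrMr// mulrAC ler_pdivlMr//.
    apply: le_trans (_ : (a - b) * (k%:R * k%:R) * d%:R <= _).
      apply: ler_pM; rewrite ?(ltW da0) ?mulr_ge0// ?ler_wpM2l// gerBl; exact: ltW.
    rewrite ler_wpM2r// ?(ltW d0)// -[leRHS]mulrA ler_wpM2l// mulrDr lerDl mulr_ge0//.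
    exact: ltW.
  rewrite [_ / _ * bd]mulrAC -mulrA; lra.
set u := b^-1 * _ in kc.
have u0 : 0 <= u by rewrite mulr_ge0 ?expR_ge0// invr_ge0 ltW.
(* At rate [b] the size is at most [k] with probability at least [1 - u]; passing to rate [a] costs
   the factor [q] and at most [expR s]. *)
have lower : q * (1 - u) * (1 - s) <= P.
  have tail : 1 - u <= Ex (edges e) (b / d%:R) (fun F => G (component F v)).
    have := @small_tail _ R (edges e) (b / d%:R) c b^-1 k%:R xpredT v.
    rewrite q0 q1 (ltW c0) => /(_ isT isT) tail.
    rewrite lerBlDr; apply: (@le_trans _ _ (Ex (edges e) (b / d%:R) (fun F => G (component F v)) +
        Ex (edges e) (b / d%:R) (fun F => (k%:R < #|component F v|%:R)%R%:R))); last first.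
      rewrite lerD2l; apply: tail; apply: le_trans (cP v).
      by apply: le_Ex => // F _; rewrite mul1r.
    rewrite -ExD -[leLHS](Ex_cst (edges e) (b / d%:R)); apply: le_Ex => // F _.
    by rewrite /G; case: lerP; rewrite ?addr0 ?add0r.
  have := component_tilt_ge er b0 (ltW ba) ad v G0.
  have -> : a / b = q^-1 by rewrite /b invfM mulrA divff ?mul1r// gt_eqF.
  rewrite ler_pdivlMl// => tilt.
  have {}tail : q * (1 - u) <= P * expR s.
    apply: le_trans (ler_wpM2l (ltW q_gt0) tail) (le_trans tilt _).
    rewrite [leRHS]mulrC -ExZ; apply: le_Ex => // F _; rewrite /G [leRHS]mulrC.
    have [Ck|_] := lerP #|component F v|%:R (k%:R : R); last by rewrite !mul0r.
    rewrite !mul1r ler_expR.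
    have -> : ln q^-1 = a - b by rewrite -lnab /b invfM mulrA divff ?mul1r// gt_eqF.
    have -> : (a - b) / (1 - a / d%:R) - (a - b) = (a - b) * a / (d%:R - a).
      field; rewrite !gt_eqF//.
    rewrite /s mulrAC ler_pM2r ?invr_gt0// /s0 -!mulrA ler_wpM2l//.
    apply: le_trans (_ : k%:R * a <= _); last by rewrite ler_wpM2l// lerDr.
    by rewrite mulrC ler_wpM2r// ltW.
  have s1' : 0 <= 1 - s by rewrite subr_ge0.
  apply: le_trans (ler_wpM2r s1' tail) _; rewrite -mulrA ler_piMr//.
  have := expR_ge1Dx (- s); rewrite expRN => /(ler_wpM2l (expR_ge0 s)).
  by rewrite mulfV ?gt_eqF ?expR_gt0.
have q1' := q_lt1; have q0' := q_gt0.
move: {c0 cP k0k c s0 s00 s010 sl dM G G0} s P u P0 P1 upper u0 kc lower s_ge0 s_le1 s_eta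
  => s P u P0 P1 upper u0 kc lower s_ge0 s_le1 s_eta.
rewrite ler_norml; apply/andP; split.
  have h1 : 0 <= (1 - q) * u by rewrite mulr_ge0// subr_ge0 ltW.
  have h2 : 0 <= (1 - q) * s by rewrite mulr_ge0// subr_ge0 ltW.
  have h3 : 0 <= q * u * s by rewrite !mulr_ge0// ltW.
  by lra.
have : 0 <= (1 - P) * s by rewrite mulr_ge0// subr_ge0.
by lra.
Qed.
End LocalLimit.

(** * Number of vertices in small components *)

Section SmallCount.
Variable R : realType.

Lemma card_small (T : finType) (F : {set {set T}}) (t : R) :
  #|small F t|%:R = \sum_v (#|component F v|%:R <= t)%R%:R :> R.
Proof.
rewrite -sum1_card natr_sum big_mkcond /=; apply: eq_bigr => v _; rewrite in_small.
by case: (_ <= _)%R.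
Qed.

(** Sizes up to a constant [k] are handled by the limit law and concentration; components of size
    between [k] and [g * n] contain few vertices by the exponential moment. Mean, fluctuation and
    these vertices each get an allowance of [eta / 4 * n]. *)
Lemma small_count (a q c g eta : R) : 0 < a -> 0 < q -> q < 1 ->
  q = expR (- (a * (1 - q))) -> a * q < 1 -> 0 < c -> 0 < g -> 0 < eta ->
  asymptotically R (fun n d e => forall v,
    Ex (edges e) (a / d%:R) (fun F => (#|component F v|%:R <= g * n%:R)%R%:R *
       expR (c * #|component F v|%:R)) <= 1) ->
  asymptotically R (fun n d e => Ex (edges e) (a / d%:R) (fun F =>
    (eta * n%:R < `|#|small F (g * n%:R)|%:R - q * n%:R|)%R%:R) <= eta).
Proof.
move=> a0 q0 q1 qE aq1 c0 g0 eta0 moment.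
have eta4 : 0 < eta / 4 by rewrite divr_gt0.
have [k0 law] := component_law_limit a0 q0 q1 qE aq1 eta4.
(* With a tail of [eta ^+ 2 / 8], Markov's inequality at level [eta / 4 * n] gives probability at
   most [eta / 2]. *)
pose k := maxn k0 (Num.truncn (8 / (c * eta ^+ 2))).+1.
have kc : expR (- (c * k%:R)) <= eta ^+ 2 / 8.
  have : 8 / (c * eta ^+ 2) <= k%:R.
    by apply: le_trans (ltW (truncnS_gt _)) _; rewrite ler_nat leq_maxr.
  rewrite ler_pdivrMr ?mulr_gt0 ?exprn_gt0// => kl.
  have := expR_ge1Dx (c * k%:R) => ek.
  rewrite expRN -[leLHS]mul1r ler_pdivrMr ?expR_gt0//.
  have e0 : 0 <= eta ^+ 2 / 8 by rewrite divr_ge0// exprn_ge0// ltW.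
  by apply: le_trans (ler_wpM2l e0 ek); lra.
have := asymptotically_and
  (asymptotically_and (law k (leq_maxl _ _)) (small_concentrated a0 k eta4))
  (asymptotically_and moment (asymptotically_degree (a + 1 + k%:R / g))).
move=> /asymptotically_imp; apply => n d e er dn [[{}law conc] [{}moment dM]].
have kg0 : 0 <= k%:R / g by rewrite divr_ge0// ltW.
have ad : a < d%:R by lra.
have d0 : 0 < d%:R :> R by apply: lt_trans ad.
have dn' : d%:R < n%:R :> R by rewrite ltr_nat.
have n0 : 0 < n%:R :> R by lra.
have kgn : k%:R <= g * n%:R by rewrite -ler_pdivrMl// mulrC; lra.
have p0 : 0 <= a / d%:R by rewrite divr_ge0// ltW.
have p1 : a / d%:R <= 1 by rewrite ler_pdivrMr// mul1r ltW.
pose mean := Ex (edges e) (a / d%:R) (fun F => #|small F (k%:R : R)|%:R).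
move: conc => /=; rewrite -/mean => conc.
have meanE : `|mean - q * n%:R| <= eta / 4 * n%:R.
  rewrite /mean (eq_Ex _ (fun F _ => card_small F _)) Ex_sum.
  have -> : q * n%:R = \sum_(v < n) q by rewrite sumr_const card_ord mulr_natr.
  rewrite -sumrB; apply: le_trans (ler_norm_sum _ _ _) _.
  apply: le_trans (ler_sum _ (fun v _ => law v)) _.
  by rewrite sumr_const card_ord mulr_natr.
pose Y (F : {set {set 'I_n}}) : R := \sum_(v < n)
  ((#|component F v|%:R <= g * n%:R)%R && ((k%:R : R) < #|component F v|%:R)%R)%:R.
have Y0 F : 0 <= Y F by apply: sumr_ge0.
have EY : Ex (edges e) (a / d%:R) Y <= eta ^+ 2 / 8 * n%:R.
  have -> : eta ^+ 2 / 8 * n%:R = \sum_(v < n) (eta ^+ 2 / 8).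
    by rewrite sumr_const card_ord mulr_natr.
  rewrite Ex_sum; apply: ler_sum => v _.
  apply: le_trans kc; rewrite -[leRHS]mul1r.
  have := @small_tail _ R (edges e) (a / d%:R) c 1 k%:R (fun X => #|X|%:R <= g * n%:R)%R v.
  by rewrite p0 p1 (ltW c0) => /(_ isT isT (moment v)).
have PY := Ex_markov p0 p1 (mulr_gt0 eta4 n0) (fun F (_ : F \subset edges e) => Y0 F).
have {}PY : Ex (edges e) (a / d%:R) (fun F => (eta / 4 * n%:R <= Y F)%R%:R) <= eta / 2.
  apply: le_trans PY _; rewrite ler_pdivrMr ?mulr_gt0//; apply: le_trans EY _.
  by rewrite (_ : eta / 2 * _ = eta ^+ 2 / 8 * n%:R)//; field.
apply: (@le_trans _ _ (eta / 4 + eta / 2)); last by lra.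
apply: le_trans (lerD conc PY); rewrite -ExD; apply: le_Ex => // F _.
have sE : #|small F (g * n%:R)|%:R = #|small F (k%:R : R)|%:R + Y F.
  rewrite !card_small -big_split; apply: eq_bigr => v _ /=.
  have [Ck|Ck] := lerP #|component F v|%:R (k%:R : R).
    by rewrite (le_trans Ck kgn) andbF addr0.
  by rewrite andbT add0r.
have [//|c1] := lerP (eta / 4 * n%:R) `|#|small F (k%:R : R)|%:R - mean|.
  by rewrite -natrD ler_nat; case: (_ < _)%R; case: (_ <= _)%R.
rewrite add0r; apply: ler_bool; apply: contraTT; rewrite -ltNge -leNgt sE => Yl.
move: meanE c1 (Y0 F) Yl; rewrite !ler_norml !ltr_norml.
move=> /andP[? ?] /andP[? ?] ? ?; apply/andP; split; lra.
Qed.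

End SmallCount.

(** * Sprinkling between large components *)

Section Sprinkling.
Variable R : realType.

Definition cross_edges n (e : rel 'I_n) (K L : {set 'I_n}) : {set {set 'I_n}} :=
  [set f in edges e | [exists x in K, exists y in L, f == [set x; y]]].

(** Polarization: mixing is applied to [K :|: L], [K] and [L]. The errors add up to
    [2 * lambda * (|K| + |L|)], halved because cross pairs are counted in both orders. *)
Lemma card_cross_edges n d (e : rel 'I_n) (K L : {set 'I_n}) :
  regular_graph e d -> [disjoint K & L] ->
  d%:R * #|K|%:R * #|L|%:R / n%:R - lambda R e * (#|K|%:R + #|L|%:R) <=
  #|cross_edges e K L|%:R :> R.
Proof.
move=> er KL; case: (er) => sym irr deg.
pose W (X Y : {set 'I_n}) := (\sum_(i in X) #|[set j in Y | e i j]|)%N.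
have WE X Y : W X Y = (\sum_(i in X) \sum_(j in Y) e i j)%N.
  apply: eq_bigr => i _; rewrite -sum1_card -big_mkcondr /=.
  by apply: eq_bigl => j; rewrite inE.
have WC X Y : W X Y = W Y X.
  rewrite !WE exchange_big; apply: eq_bigr => i _; apply: eq_bigr => j _.
  by rewrite sym.
have WU X : W X (K :|: L) = (W X K + W X L)%N.
  rewrite !WE -big_split; apply: eq_bigr => i _ /=.
  by rewrite -bigU//=; apply: eq_bigl => j; rewrite !inE.
have WKL : (W K L <= #|cross_edges e K L|)%N.
  rewrite /W -(card_pairs K (fun a w => (w \in L) && e a w)).
  rewrite -(@card_in_imset _ _ (fun u => [set u.1; u.2])); last first.
    move=> [x y] [x' y']; rewrite !inE/= => /and3P[xK yL _] /and3P[x'K y'L _] eq.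
    have : x \in [set x'; y'] by rewrite -eq set21.
    have : y \in [set x'; y'] by rewrite -eq set22.
    have nK z : z \in L -> z \in K = false.
      by move=> zL; apply/negbTE; apply: contraTN zL => zK; rewrite (disjointFr KL zK).
    rewrite !in_set2 => /orP[]/eqP yE /orP[]/eqP xE; move: xK yL x'K y'L.
    - by rewrite yE => _ /nK ->.
    - by rewrite yE => _ /nK ->.
    - by rewrite yE xE.
    - by rewrite xE => yK _ _ /nK; rewrite yK.
  apply/subset_leq_card/subsetP => f /imsetP[[x y]]; rewrite inE/= => /and3P[xK yL xy] ->.
  rewrite inE; apply/andP; split; first by apply/edgesP; exists x, y.
  by apply/existsP; exists x; rewrite xK; apply/existsP; exists y; rewrite yL eqxx.
have := mixing R er (K :|: L); have := mixing R er K; have := mixing R er L.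
rewrite -/(W (K :|: L) (K :|: L)) -/(W K K) -/(W L L).
rewrite WU (WC _ K) (WC _ L) !WU !natrD.
have -> : #|K :|: L|%:R = #|K|%:R + #|L|%:R :> R.
  by rewrite cardsU disjoint_setI0// cards0 subn0 natrD.
rewrite !ler_norml => /andP[_ h1] /andP[_ h2] /andP[h3 _].
move: WKL; rewrite -(ler_nat R); apply: le_trans; move: h1 h2 h3.
rewrite (WC L K); move: #|K|%:R #|L|%:R => k l.
have -> : d%:R * (k + l) ^+ 2 / n%:R =
    d%:R * k ^+ 2 / n%:R + d%:R * l ^+ 2 / n%:R + 2 * (d%:R * k * l / n%:R).
  by ring.
lra.
Qed.

(** Two distinct components of [F1] larger than [g * n] are joined by at least [g ^+ 2 / 2 * d * n]
    edges of the graph. The second round misses each with probability at most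
    [expR (- ((a - a1) / d))], hence all of them with probability at most [expR (- (th * n))]; a
    union bound over pairs of vertices concludes. *)
Lemma sprinkle (a1 a g eta : R) : 0 < a1 -> a1 < a -> 0 < g -> 0 < eta ->
  asymptotically R (fun n d e => forall F1 : {set {set 'I_n}},
    Ex (edges e) (1 - (1 - a / d%:R) / (1 - a1 / d%:R)) (fun F2 =>
      [exists u, exists v, [&& u \notin small F1 (g * n%:R), v \notin small F1 (g * n%:R)
        & v \notin component (F1 :|: F2) u]]%:R) <= eta).
Proof.
move=> a10 a1a g0 eta0; have a0 := lt_trans a10 a1a.
pose th := (a - a1) * g ^+ 2 / 2.
have th0 : 0 < th by rewrite divr_gt0// mulr_gt0 ?subr_gt0// exprn_gt0.
have g20 : 0 < g ^+ 2 / 2 by rewrite divr_gt0// exprn_gt0.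
have := asymptotically_and (asymptotically_lambda g20)
  (asymptotically_degree (a + 1 + 6 / (th ^+ 3 * eta))).
move=> /asymptotically_imp; apply => n d e er dn [lg dM] F1.
have M0 : 0 <= 6 / (th ^+ 3 * eta) by rewrite divr_ge0// mulr_ge0 ?exprn_ge0 ?ltW.
have ad : a < d%:R by lra.
have d0 : 0 < d%:R :> R by apply: lt_trans ad.
have dn' : d%:R < n%:R :> R by rewrite ltr_nat.
have n0 : 0 < n%:R :> R by lra.
have p1 : a / d%:R < 1 by rewrite ltr_pdivrMr// mul1r.
have p11 : a1 / d%:R < 1 by rewrite ltr_pdivrMr// mul1r (lt_trans a1a).
have p12 : a1 / d%:R <= a / d%:R by rewrite ler_wpM2r ?invr_ge0 ?ltW.
have p10 : 0 <= a1 / d%:R by rewrite divr_ge0// ltW.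
set p2 := 1 - _; have p2E : 1 - p2 <= expR (- ((a - a1) / d%:R)).
  have -> : 1 - p2 = (1 - a / d%:R) / (1 - a1 / d%:R) by rewrite /p2 opprB addrC subrK.
  rewrite (_ : (a - a1) / d%:R = a / d%:R - a1 / d%:R); last by rewrite mulrBl.
  rewrite expRN -[leLHS]invrK invf_div lef_pV2 ?posrE ?expR_gt0//.
    exact: odds_ratio_ge.
  by rewrite divr_gt0// subr_gt0.
have r0 : 0 <= (1 - a / d%:R) / (1 - a1 / d%:R) by rewrite divr_ge0// subr_ge0 ltW.
have r1 : (1 - a / d%:R) / (1 - a1 / d%:R) <= 1.
  by rewrite ler_pdivrMr ?subr_gt0// mul1r lerD2l lerN2.
have p20 : 0 <= p2 by rewrite subr_ge0.
have p21 : p2 <= 1 by rewrite gerBl.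
pose bad u v (F2 : {set {set 'I_n}}) :=
  [&& u \notin small F1 (g * n%:R), v \notin small F1 (g * n%:R)
        & v \notin component (F1 :|: F2) u].
have badP u v : Ex (edges e) p2 (fun F2 => (bad u v F2)%:R) <= expR (- (th * n%:R)).
  have [uL|uS] := boolP (u \in small F1 (g * n%:R)).
    by rewrite (eq_Ex _ (g := fun=> 0)) ?Ex_cst ?expR_ge0// => F _; rewrite /bad uL.
  have [vL|vS] := boolP (v \in small F1 (g * n%:R)).
    by rewrite (eq_Ex _ (g := fun=> 0)) ?Ex_cst ?expR_ge0// => F _; rewrite /bad vL andbF.
  have [uv|uv] := boolP (v \in component F1 u).
    rewrite (eq_Ex _ (g := fun=> 0)) ?Ex_cst ?expR_ge0// => F _.
    by rewrite /bad (subsetP (component_sub _ (subsetUl F1 F)) _ uv) !andbF.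
  set K := component F1 u; set L := component F1 v.
  have KL : [disjoint K & L].
    apply/pred0P => z /=; apply/negbTE; apply: contra uv => /andP[zK zL].
    by rewrite -(component_eq zK) (component_eq zL) component_refl.
  apply: (@le_trans _ _ ((1 - p2) ^+ #|cross_edges e K L|)).
    rewrite -(@Ex_disjoint _ _ (edges e)); last by apply/subsetP => f; rewrite inE => /andP[].
    apply: le_Ex => // F2 _; apply: ler_bool => /and3P[_ _].
    apply: contraR => /pred0Pn[f /= /andP[fF]].
    rewrite inE => /andP[_ /existsP[x /andP[xK /existsP[y /andP[yL /eqP fxy]]]]].
    have xU : x \in component (F1 :|: F2) u by apply: subsetP xK; apply/component_sub/subsetUl.
    have yU : y \in component (F1 :|: F2) u by apply: reach_closed xU _; rewrite -fxy inE fF orbT.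
    rewrite -(component_eq yU); have yv : v \in component F1 y.
      by rewrite (component_eq yL) component_refl.
    by apply: subsetP yv; apply/component_sub/subsetUl.
  have {}p2E : (1 - p2) ^+ #|cross_edges e K L| <=
      expR (- ((a - a1) / d%:R)) ^+ #|cross_edges e K L|.
    by rewrite lerXn2r ?nnegrE ?expR_ge0// subr_ge0.
  apply: le_trans p2E _; rewrite -expRM_natr ler_expR mulNr lerN2.
  have cross := card_cross_edges er KL.
  move: uS vS; rewrite !in_small -!ltNge -/K -/L => uS vS.
  have KLn : #|K|%:R + #|L|%:R <= n%:R :> R.
    rewrite -natrD ler_nat -[leqRHS]card_ord -cardsT.
    rewrite (_ : (#|K| + #|L|)%N = #|K :|: L|) ?subset_leq_card ?subsetT//.
    by rewrite cardsU disjoint_setI0// cards0 subn0.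
  have : g ^+ 2 / 2 * d%:R * n%:R <= #|cross_edges e K L|%:R.
    apply: le_trans cross; have := ler_pM (lambda_ge0 R e) (addr_ge0 _ _) lg KLn.
    rewrite !ler0n => /(_ isT isT) h1.
    have h2 : g * n%:R * (g * n%:R) <= #|K|%:R * #|L|%:R.
      by rewrite ler_pM ?mulr_ge0 ?ltW.
    have : d%:R * (g * n%:R * (g * n%:R)) / n%:R <= d%:R * #|K|%:R * #|L|%:R / n%:R.
      by rewrite -[d%:R * #|K|%:R * _]mulrA ler_wpM2r ?invr_ge0 ?(ltW n0)// ler_wpM2l// ltW.
    have -> : d%:R * (g * n%:R * (g * n%:R)) / n%:R = g ^+ 2 * d%:R * n%:R.
      by field; rewrite gt_eqF.
    lra.
  have aa0 : 0 <= (a - a1) / d%:R by rewrite divr_ge0 ?subr_ge0 ?ltW.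
  move=> /(ler_wpM2l aa0); apply: le_trans.
  by rewrite (_ : _ / _ * _ = th * n%:R)// /th; field; rewrite gt_eqF.
apply: (@le_trans _ _ (\sum_(u < n) \sum_(v < n) expR (- (th * n%:R)))).
  apply: (@le_trans _ _ (\sum_u \sum_v Ex (edges e) p2 (fun F2 => (bad u v F2)%:R))); last first.
    by apply: ler_sum => u _; apply: ler_sum => v _.
  under eq_bigr => u _ do rewrite -Ex_sum.
  rewrite -Ex_sum; apply: le_Ex => // F2 _.
  case: existsP => [[u /existsP[v uv]]|_]; last by apply: sumr_ge0 => u _; apply: sumr_ge0.
  rewrite (bigD1 u)//= (bigD1 v)//= {1}/bad uv -addrA lerDl.
  by rewrite addr_ge0// ?sumr_ge0// => w _; rewrite sumr_ge0.
rewrite !sumr_const card_ord -mulrnA -[_ *+ _]mulr_natr natrM expRN.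
(* The bound [expR x >= x ^+ 3 / 6] beats the [n ^+ 2] pairs of the union bound. *)
have := @expR_ge1Dxn R (th * n%:R) 2; rewrite mulr_ge0 ?(ltW th0)// => /(_ isT) h.
rewrite mulrC ler_pdivrMr ?expR_gt0//.
have h' : (th * n%:R) ^+ 3 / 6 <= expR (th * n%:R).
  by apply: le_trans h; rewrite (_ : (3`!)%:R = 6 :> R)// lerDr.
apply: le_trans (ler_wpM2l (ltW eta0) h').
have nM : 6 / (th ^+ 3 * eta) <= n%:R by move: (6 / (th ^+ 3 * eta)) M0 dM => Z; lra.
have t30 : 0 < th ^+ 3 * eta by rewrite mulr_gt0// exprn_gt0.
rewrite ler_pdivrMr// in nM.
have := ler_wpM2r (mulr_ge0 (ltW n0) (ltW n0)) nM; move: (th) n%:R => t x; lra.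
Qed.

End Sprinkling.

(** * Uniqueness and size of the giant component *)

Section Giant.
Variable R : realType.

(** Union bound: outside four bad events the good one holds. *)
Lemma ler1_bool (g b1 b2 b3 b4 : bool) : (~~ b1 -> ~~ b2 -> ~~ b3 -> ~~ b4 -> g) ->
  1 <= g%:R + ((b1%:R + b2%:R) + (b3%:R + b4%:R)) :> R.
Proof.
move=> h; rewrite -!natrD ler1n; move: h.
by case: b1 b2 b3 b4 => [] [] [] [] /=; rewrite ?addnS ?addn0// => /(_ isT isT isT isT) ->.
Qed.

Lemma componentsP (T : finType) (F : {set {set T}}) K :
  reflect (exists v, K = component F v) (K \in components F).
Proof.
have E v : [set y in [set: T] | connect [rel x y | [set x; y] \in F] v y] = component F v.
  by apply/setP => y; rewrite mem_component !inE.
apply: (iffP imsetP) => [[v _ ->]|[v ->]]; exists v; rewrite ?inE ?E//.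
Qed.

(** The equation is solved for the rate with extinction probability [q1]; raising the extinction
    probability from [q] to [q1] lowers the rate, which leaves room for sprinkling. *)
Lemma dual_parameter (a q q1 : R) : 0 < a -> 0 < q -> q < q1 -> q1 < 1 ->
  q = expR (- (a * (1 - q))) -> a * q1 < 1 ->
  exists a1, [/\ 1 < a1, a1 < a, a1 * q1 < 1 & q1 = expR (- (a1 * (1 - q1)))].
Proof.
move=> a0 q0 qq1 q11 qE aq1; exists (- ln q1 / (1 - q1)).
have q10 := lt_trans q0 qq1; have d0 : 0 < 1 - q1 by rewrite subr_gt0.
split.
- by rewrite ltr_pdivlMr// mul1r; have := ln_ltB1 q10 (negbT (lt_eqF q11)); lra.
- rewrite ltr_pdivrMr//; have lnq : ln q = - (a * (1 - q)) by rewrite {1}qE expRK.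
  have qq : q / q1 != 1 by rewrite lt_eqF// ltr_pdivrMr// mul1r.
  have := ln_ltB1 (divr_gt0 q0 q10) qq; rewrite ln_div ?posrE// lnq => h.
  (* This uses [a <= q1^-1]; with [ln (q / q1) < q / q1 - 1] it gives [a1 < a]. *)
  have : a * (q1 - q) <= 1 - q / q1.
    rewrite (_ : 1 - q / q1 = q1^-1 * (q1 - q)); last by field; rewrite gt_eqF.
    by rewrite ler_wpM2r ?subr_ge0 ?(ltW qq1)// -[leRHS]mul1r ler_pdivlMr// ltW.
  lra.
- have : q1^-1 != 1 by rewrite gt_eqF// invf_gt1.
  move=> /(ln_ltB1 _); rewrite invr_gt0 => /(_ q10); rewrite lnV ?posrE// => h.
  rewrite mulrAC ltr_pdivrMr// mul1r -ltr_pdivlMr//.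
  by rewrite mulrBl mul1r divff ?gt_eqF.
- by rewrite divfK ?gt_eqF// opprK lnK ?posrE.
Qed.

Section Deterministic.
Variables (n : nat) (F : {set {set 'I_n}}) (q g : R).
Hypothesis n0 : (0 < n)%N.

(** All vertices large for [F1], about [(1 - q1) * n] of them, lie in one component of [F]. Another
    component above [g * n] would have to fit among the remaining large vertices of [F], of which
    there are at most [(q1 - q + 2 * eps) * n <= g * n]. *)
Lemma unique_large_component (F1 : {set {set 'I_n}}) (q1 g1 eps : R) :
  q1 - q + 2 * eps <= g -> g < 1 - q1 - eps -> 0 <= g ->
  `|#|small F1 (g1 * n%:R)|%:R - q1 * n%:R| <= eps * n%:R ->
  `|#|small F (g * n%:R)|%:R - q * n%:R| <= eps * n%:R ->
  (forall u v, u \notin small F1 (g1 * n%:R) -> v \notin small F1 (g1 * n%:R) ->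
    v \in component F u) ->
  exists u, forall w, (w \notin small F (g * n%:R)) = (w \in component F u).
Proof.
move=> qg gq gge0 h1 h3 h2; have n0' : 0 < n%:R :> R by rewrite ltr0n.
set S1 := small F1 _ in h1 h2; set S := small F _ in h3 *.
have cardC (X : {set 'I_n}) : #|~: X|%:R = n%:R - #|X|%:R :> R.
  have := cardsC X; rewrite card_ord => /(congr1 (fun m => m%:R : R)).
  by rewrite natrD; lra.
have V1 : g * n%:R < #|~: S1|%:R.
  rewrite cardC; have := ltr_pM2r n0' g (1 - q1 - eps); rewrite gq.
  by move: h1; rewrite ler_norml => /andP[_]; lra.
have [u uS1] : exists u, u \notin S1.
  have /card_gt0P[u] : (0 < #|~: S1|)%N.
    by rewrite -(ltr_nat R); apply: le_lt_trans V1; rewrite mulr_ge0// ltW.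
  by rewrite inE; exists u.
have K1 : g * n%:R < #|component F u|%:R.
  apply: lt_le_trans V1 _; rewrite ler_nat; apply/subset_leq_card/subsetP => v.
  by rewrite inE => /(h2 u v uS1).
have uL w : w \in component F u -> w \notin S.
  by move=> wu; rewrite in_small (component_eq wu) -ltNge.
exists u => w; apply/idP/idP => [wS|]; last exact: uL.
apply: contraT => wu.
have wL z : z \in component F w -> z \notin S.
  by move=> zw; rewrite in_small (component_eq zw) -in_small.
have : (#|component F w| + #|~: S1| <= #|~: S|)%N.
  apply: leq_trans (_ : #|component F w :|: component F u| <= _)%N; last first.
    apply/subset_leq_card/subsetP => z; rewrite in_setU in_setC => /orP[/wL//|/uL//].
  rewrite cardsU (_ : _ :&: _ = set0) ?cards0 ?subn0 ?leq_add2l.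
    by apply/subset_leq_card/subsetP => v; rewrite inE => /(h2 u v uS1).
  apply/setP => z; rewrite !in_setI in_set0; apply/negbTE/negP => /andP[zw zu].
  by move: wu; rewrite -(component_eq zu) (component_eq zw) component_refl.
rewrite -(ler_nat R) natrD !cardC.
move: wS; rewrite in_small -ltNge => wg.
have := ler_pM2r n0' (q1 - q + 2 * eps) g; rewrite qg.
move: h1 h3; rewrite !ler_norml => /andP[? ?] /andP[? ?] ? ?; lra.
Qed.

(** The component of [u] consists of all large vertices, so its size is within [eps * n] of [m].
    Every other component has at most [g * n < (1 - del) * m] vertices, too few for a giant, and
    then at most [M]. *)
Lemma giants_large_component (eps del M : R) u : 0 <= eps ->
  (forall w, (w \notin small F (g * n%:R)) = (w \in component F u)) ->
  `|#|small F (g * n%:R)|%:R - q * n%:R| <= eps * n%:R ->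
  eps <= del * (1 - q) -> g < (1 - del) * (1 - q) ->
  (forall v, #|component F v|%:R <= g * n%:R -> #|component F v|%:R <= M) ->
  let m := (1 - q) * n%:R in
  (#|giants F m del| == 1%N) &&
  [forall K in components F :\: giants F m del, #|K|%:R <= M].
Proof.
move=> eps0 uP h3 ed gd med /=; set m := (1 - q) * _; have n0' : 0 < n%:R :> R by rewrite ltr0n.
have Ku : #|component F u|%:R = n%:R - #|small F (g * n%:R)|%:R :> R.
  rewrite (_ : component F u = ~: small F (g * n%:R)); last first.
    by apply/setP => w; rewrite in_setC uP.
  have := cardsC (small F (g * n%:R)); rewrite card_ord => /(congr1 (fun m => m%:R : R)).
  by rewrite natrD; lra.
have gE : giants F m del = [set component F u].
  apply/setP => K; rewrite inE in_set1; apply/andP/eqP => [[/componentsP[v ->] Km]|->].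
    apply/component_eq; rewrite -uP in_small -ltNge.
    move: Km; rewrite ler_norml => /andP[+ _]; rewrite /m.
    by have := ltr_pM2r n0' g ((1 - del) * (1 - q)); rewrite gd; lra.
  split; first by apply/componentsP; exists u.
  have := ler_pM2r n0' eps (del * (1 - q)); rewrite ed Ku /m.
  move: h3; rewrite !ler_norml => /andP[? ?] ?; apply/andP; split; lra.
rewrite gE cards1 eqxx /=; apply/forallP => K; apply/implyP.
rewrite in_setD in_set1 => /andP[Ku' /componentsP[v Kv]]; move: Ku'; rewrite Kv => vu.
apply: med; rewrite -in_small; apply: contraNT vu; rewrite uP => vu.
by rewrite (component_eq vu).
Qed.

End Deterministic.

Lemma subcritical_components (a : R) : 0 < a -> a < 1 -> exists2 C : R, 0 < C &
  forall eta : R, 0 < eta -> asymptotically R (fun n d e =>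
    1 - eta <= random_subset_prob (edges e) (a / d%:R)
      (fun F => [forall K in components F, #|K|%:R <= C * ln (n%:R : R)])).
Proof.
move=> a0 a1; have [c c0 moment] := subcritical_moment a0 a1.
exists (2 / c); first by rewrite divr_gt0.
move=> eta eta0; have := asymptotically_and moment (asymptotically_degree (a + a^-1 / eta)).
move=> /asymptotically_imp; apply => n d e er dn [{}moment dM].
have M0 : 0 < a^-1 / eta by rewrite divr_gt0// invr_gt0.
have ad : a < d%:R by lra.
have d0 : 0 < d%:R :> R by apply: lt_trans ad.
have n0 : (0 < n)%N by apply: leq_ltn_trans dn.
have dn' : d%:R < n%:R :> R by rewrite ltr_nat.
have n0' : 0 < n%:R :> R by rewrite ltr0n.
have p0 : 0 <= a / d%:R by rewrite divr_ge0// ltW.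
have p1 : a / d%:R <= 1 by rewrite ler_pdivrMr// mul1r ltW.
have p01 : 0 <= a / d%:R <= 1 by rewrite p0.
have := @no_medium_component R n (edges e) (a / d%:R) c a^-1 xpredT n0 p01 c0.
have mom v : Ex (edges e) (a / d%:R) (fun F => true%:R * expR (c * #|component F v|%:R)) <= a^-1.
  by apply: le_trans (moment v); apply: le_Ex => // F _; rewrite mul1r.
move=> /(_ mom) bad; rewrite random_subset_probE lerBlDr.
have {}bad := le_trans bad (_ : a^-1 / n%:R <= eta).
apply: le_trans (lerD (lexx _) (bad _)); last first.
  rewrite ler_pdivrMr// mulrC -ler_pdivrMr//; move: (a^-1 / eta) dM => Z dM; lra.
rewrite -ExD -[leLHS](Ex_cst (edges e) (a / d%:R)); apply: le_Ex => // F _ /=.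
case: existsP => [_|nex]; first by rewrite lerDr ler0n.
rewrite (_ : [forall _ in _, _]) ?addr0//; apply/forallP => K; apply/implyP => /componentsP[v ->].
by rewrite leNgt; apply/negP => Cv; apply: nex; exists v.
Qed.

Lemma supercritical_components (a q : R) : 1 < a -> 0 < q -> q < 1 ->
  q = expR (- (a * (1 - q))) -> a * q < 1 -> exists2 C : R, 0 < C &
  forall del eta : R, 0 < del -> del <= 1 / 2 -> 0 < eta -> asymptotically R (fun n d e =>
    1 - eta <= random_subset_prob (edges e) (a / d%:R) (fun F =>
      let m := (1 - q) * n%:R in
      (#|giants F m del| == 1%N) &&
      [forall K in components F :\: giants F m del, #|K|%:R <= C * ln (n%:R : R)])).
Proof.
move=> a1 q0 q1 qE aq1; have a0 := lt_trans ltr01 a1.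
have [c [g' [c0 g'0 moment']]] := supercritical_moment a1.
(* [g'] secures the moment bound; [(1 - q) / 4] keeps [g * n] below the size of a giant when
   [del <= 1 / 2]. *)
pose g := Num.min g' ((1 - q) / 4).
have g0 : 0 < g by rewrite lt_min g'0 divr_gt0// subr_gt0.
have gg' : g <= g' by rewrite ge_min lexx.
have gq : g <= (1 - q) / 4 by rewrite ge_min lexx orbT.
exists (2 / c); first by rewrite divr_gt0.
(* Extinction probability of the first round: at most [q + g / 2], so few large vertices are left
   outside its large set, and below [a^-1], as [dual_parameter] requires. *)
pose q2 := q + Num.min (g / 2) ((a^-1 - q) / 2).
have aq : q < a^-1 by rewrite -[ltRHS]mul1r ltr_pdivlMr// mulrC.
have aV1 : a^-1 < 1 by rewrite invf_lt1.
have m0 : 0 < Num.min (g / 2) ((a^-1 - q) / 2) by rewrite lt_min !divr_gt0// subr_gt0.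
have m1 : Num.min (g / 2) ((a^-1 - q) / 2) <= g / 2 by rewrite ge_min lexx.
have m2 : Num.min (g / 2) ((a^-1 - q) / 2) <= (a^-1 - q) / 2 by rewrite ge_min lexx orbT.
have qq2 : q < q2 by rewrite /q2; lra.
have q2a : q2 < a^-1 by rewrite /q2; lra.
have q2g : q2 <= q + g / 2 by rewrite /q2; lra.
have aq2 : a * q2 < 1 by rewrite -ltr_pdivlMl// mulr1.
have q21 := lt_trans q2a aV1; have q20 := lt_trans q0 qq2.
have [a2 [a21 a2a a2q2 q2E]] := dual_parameter a0 q0 qq2 q21 qE aq2.
have a20 := lt_trans ltr01 a21.
have [c2 [g2 [c20 g20 moment2]]] := supercritical_moment a21.
move=> del eta del0 del1 eta0.
(* This ensures [q2 - q + 2 * eps <= g], divides [eta] among four bad events, and keeps the giant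
   within relative error [del]. *)
pose eps := Num.min (Num.min (g / 4) (eta / 4)) (del * (1 - q)).
have eps0 : 0 < eps by rewrite !lt_min !divr_gt0//= mulr_gt0// subr_gt0.
have epsg : eps <= g / 4 by rewrite !ge_min lexx.
have epse : eps <= eta / 4 by rewrite !ge_min lexx orbT.
have epsd : eps <= del * (1 - q) by rewrite !ge_min lexx !orbT.
have {moment'}moment : asymptotically R (fun n d e => forall v,
    Ex (edges e) (a / d%:R) (fun F => (#|component F v|%:R <= g * n%:R)%R%:R *
       expR (c * #|component F v|%:R)) <= 1).
  have := asymptotically_and moment' (asymptotically_degree a).
  move=> /asymptotically_imp; apply => n d e er dn [{}moment' ad] v.
  have d0 : 0 < d%:R :> R by apply: lt_le_trans ad.
  apply: le_trans (moment' v); apply: le_Ex.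
  - by rewrite divr_ge0// ltW.
  - by rewrite ler_pdivrMr// mul1r.
  move=> F _; rewrite ler_wpM2r ?expR_ge0//; apply: ler_bool => /le_trans; apply.
  by rewrite ler_wpM2r.
have := asymptotically_and (asymptotically_and
   (small_count a0 q0 q1 qE aq1 c0 g0 eps0 moment)
   (small_count a20 q20 q21 q2E a2q2 c20 g20 eps0 moment2))
  (asymptotically_and (sprinkle a20 a2a g20 eps0)
    (asymptotically_and moment (asymptotically_degree (a + 1 + eps^-1)))).
move=> /asymptotically_imp; apply => n d e er dn [[cnt cnt2] [spr [{}moment dM]]].
have M0 : 0 < eps^-1 by rewrite invr_gt0.
have ad : a < d%:R by lra.
have d0 : 0 < d%:R :> R by apply: lt_trans ad.
have n0 : (0 < n)%N by apply: leq_ltn_trans dn.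
have dn' : d%:R < n%:R :> R by rewrite ltr_nat.
have n0' : 0 < n%:R :> R by rewrite ltr0n.
have p0 : 0 <= a / d%:R by rewrite divr_ge0// ltW.
have p1 : a / d%:R <= 1 by rewrite ler_pdivrMr// mul1r ltW.
have p01 : 0 <= a / d%:R <= 1 by rewrite p0.
have p20 : 0 <= a2 / d%:R by rewrite divr_ge0// ltW.
have p21 : a2 / d%:R < 1 by rewrite ltr_pdivrMr// mul1r (lt_trans a2a).
have p22 : a2 / d%:R <= a / d%:R by rewrite ler_wpM2r ?invr_ge0 ?ltW.
have med := no_medium_component (Q := fun X => #|X|%:R <= g * n%:R)%R n0 p01 c0 moment.
have {}med := le_trans med (_ : 1 / n%:R <= eps).
have {}med : Ex (edges e) (a / d%:R) (fun F => [exists v, (#|component F v|%:R <= g * n%:R)%R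
    && (2 / c * ln n%:R < #|component F v|%:R)%R]%:R) <= eps.
  by apply: med; rewrite ler_pdivrMr// -ler_pdivrMl// mulr1; lra.
set pe := 1 - (1 - a / d%:R) / (1 - a2 / d%:R) in spr.
have r0 : 0 <= (1 - a / d%:R) / (1 - a2 / d%:R) by rewrite divr_ge0// subr_ge0// ltW.
have r1 : (1 - a / d%:R) / (1 - a2 / d%:R) <= 1.
  by rewrite ler_pdivrMr ?subr_gt0// mul1r lerD2l lerN2.
have pe0 : 0 <= pe by rewrite subr_ge0.
have pe1 : pe <= 1 by rewrite gerBl.
have pE : 1 - a / d%:R = (1 - a2 / d%:R) * (1 - pe).
  by rewrite /pe subKr [RHS]mulrC divfK// gt_eqF// subr_gt0.
rewrite random_subset_probE lerBlDr.
set good := (fun F : {set {set 'I_n}} => _ : R).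
pose bads (F1 F2 : {set {set 'I_n}}) : R := [exists u, exists v, [&& u \notin small F1 (g2 * n%:R),
   v \notin small F1 (g2 * n%:R) & v \notin component (F1 :|: F2) u]]%:R.
have spr' : Ex (edges e) (a2 / d%:R) (fun F1 => Ex (edges e) pe (bads F1)) <= eps.
  rewrite -[leRHS](Ex_cst (edges e) (a2 / d%:R)); apply: le_Ex => [||F1 _]; rewrite ?(ltW p21)//.
  exact: spr.
apply: (@le_trans _ _ (Ex (edges e) (a / d%:R) good + (eps + eps + (eps + eps)))); last first.
  by rewrite lerD2l; lra.
apply: le_trans (lerD (lexx _) (lerD (lerD cnt med) (lerD cnt2 spr'))).
(* The events at rate [a] are rewritten over two rounds, [F1] at rate [a2] and [F2] with probability
   [pe], so that all four bad events live on one probability space. *)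
rewrite -!ExD addrA -ExD (Ex_setU _ _ pE) -ExD.
rewrite -[leLHS](Ex_cst (edges e) (a2 / d%:R)); apply: le_Ex => //; first exact: ltW.
move=> F1 _; rewrite -[X in _ + (X + _)](Ex_cst (edges e) pe) -!ExD.
rewrite -[leLHS](Ex_cst (edges e) pe); apply: le_Ex => // F2 _.
rewrite -addrA; apply: ler1_bool => b1 b2 b3 b4.
rewrite -leNgt in b1; rewrite -leNgt in b3.
have big u v : u \notin small F1 (g2 * n%:R) -> v \notin small F1 (g2 * n%:R) ->
    v \in component (F1 :|: F2) u.
  move=> uS vS; apply: contraT => uv; move: b4; rewrite negb_exists => /forallP/(_ u).
  by rewrite negb_exists => /forallP/(_ v); rewrite uS vS uv.
have [u uP] : exists u, forall w,
    (w \notin small (F1 :|: F2) (g * n%:R)) = (w \in component (F1 :|: F2) u).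
  by apply: (unique_large_component n0 _ _ (ltW g0) b3 b1 big); lra.
apply: (giants_large_component n0 (ltW eps0) uP b1 epsd).
  have : del * (1 - q) <= 1 / 2 * (1 - q) by rewrite ler_wpM2r// subr_ge0 ltW.
  lra.
move=> v vg; rewrite leNgt; apply/negP => vC; move: b2; rewrite negb_exists => /forallP/(_ v).
by rewrite vg vC.
Qed.

End Giant.

(** * Passage to the limit along the sequence of graphs *)

Local Open Scope classical_set_scope.
Local Open Scope ring_scope.

Section Final.
Variable R : realType.

(** The function [x * expR (- x)] vanishes at 0 and exceeds its value at [alpha] when [x = 1], so
    the intermediate value theorem provides a root and [conjugate_root] is not the default value.
    Rearranging its equation gives the fixed-point equation for [q]. *)
Lemma conjugate_rootP (alpha : R) : 1 < alpha ->
  let q := conjugate_root alpha / alpha in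
  [/\ 0 < q, q < 1, q = expR (- (alpha * (1 - q))) & alpha * q < 1].
Proof.
move=> a1 q; have a0 := lt_trans ltr01 a1.
pose f (x : R) := x * expR (- x).
have fa0 : 0 < f alpha by rewrite mulr_gt0// expR_gt0.
have fa1 : f alpha < f 1.
  rewrite /f mul1r -[X in X * _](lnK (_ : alpha \in Num.pos)) ?posrE// -expRD ltr_expR.
  by have := ln_ltB1 a0 (negbT (gt_eqF a1)); lra.
have [x x01 fx] : exists2 x, x \in `[0, 1]%R & f x = f alpha.
  apply: IVT => //.
    apply: continuous_subspaceT => x; apply: cvgM; first exact: cvg_id.
    by apply: continuous_comp; [exact: opp_continuous|exact: continuous_expR].
  by rewrite /f mul0r -/(f 1) ge_min le_max (ltW fa0) (ltW fa1) orbT.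
have [c1 ca fc] : [/\ conjugate_root alpha < 1, conjugate_root alpha != alpha &
    conjugate_root alpha * expR (- conjugate_root alpha) = alpha * expR (- alpha)].
  apply: (@xgetPex _ 0 [set x | [/\ x < 1, x != alpha &
    x * expR (- x) = alpha * expR (- alpha)]]%classic).
  exists x; move: x01; rewrite in_itv/= => /andP[x0 x1].
  have {}x1 : x < 1.
    by rewrite lt_neqAle x1 andbT; apply: contraTneq fa1 => <-; rewrite fx ltxx.
  by split=> //; rewrite lt_eqF// (lt_trans x1).
have c0 : 0 < conjugate_root alpha.
  by rewrite -(pmulr_lgt0 _ (expR_gt0 (- conjugate_root alpha))) fc.
have aq : alpha * q = conjugate_root alpha by rewrite /q mulrC divfK// gt_eqF.
split.
- by rewrite divr_gt0.
- by rewrite ltr_pdivrMr// mul1r (lt_trans c1).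
- rewrite mulrBr mulr1 aq opprB expRB /q.
  rewrite -[X in X / _]mulr1 -(expRxMexpNx_1 (conjugate_root alpha)).
  rewrite [expR _ * _]mulrC mulrA fc -expRN mulrC mulrA [in RHS]mulrC mulrA mulVf ?mul1r// gt_eqF//.
- by rewrite aq.
Qed.

Variables (N : set nat) (d : nat -> nat) (G : forall n : nat, rel 'I_n).
Arguments G : clear implicits.
Hypothesis N_gt0 : forall n, N n -> (0 < n)%N.
Hypothesis G_regular : forall n, N n -> regular_graph (G n) (d n).
Hypothesis d_infty : (d n @[n --> within N \oo] --> \oo)%classic.
Hypothesis lambda_small : (fun n => lambda R (G n)) =o_ (within N \oo)
                    (fun n => (d n)%:R : R).

Lemma near_asymptotically P : asymptotically R P ->
  \forall n \near within N \oo, P n (d n) (G n).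
Proof.
move=> [D h].
(* [D.+1] keeps this constant positive even for [D = 0]. *)
have e0 : 0 < D.+1%:R^-1 :> R by rewrite invr_gt0.
have dD : \forall n \near within N \oo, (D <= d n)%N.
  exact: (d_infty (nbhs_infty_ge D)).
have /eqoP/(_ _ e0) lD := lambda_small.
have NN : \forall n \near within N \oo, N n by exact: near_withinT.
near=> n.
have Nn : N n by near: n.
apply: h; [exact: G_regular|exact: N_gt0|by near: n|].
have : `|lambda R (G n)| <= D.+1%:R^-1 * `|(d n)%:R : R| by near: n.
rewrite ger0_norm ?lambda_ge0// ger0_norm// ler_pdivlMl// mulrC.
by apply: le_trans; rewrite ler_wpM2l ?lambda_ge0// ler_nat.
Unshelve. all: by end_near.
Qed.

Lemma near_within_ge m : \forall n \near within N \oo, (m <= n)%N.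
Proof. by rewrite near_withinE; near=> n => _; near: n; exact: nbhs_infty_ge.
Unshelve. all: by end_near.
Qed.

Lemma whp_lower (P : nat -> R) :
  (forall eta : R, 0 < eta -> \forall n \near within N \oo, 1 - eta <= P n) ->
  (\forall n \near within N \oo, P n <= 1) -> whp N P.
Proof.
move=> lo up; apply/cvgrPdist_le => eta eta0; near=> n.
have Pn : P n <= 1 by near: n.
by rewrite ger0_norm ?subr_ge0// lerBlDr -lerBlDl; near: n; exact: lo.
Unshelve. all: by end_near.
Qed.

(** [mu n] is the largest [m <= n] whose bound [1 - 1 / (m + 1)] already holds at [n]. Each fixed
    [M] is eventually eligible, so [mu] tends to infinity while its own bound tends to 1. This turns
    a statement for each fixed tolerance into one whose tolerance tends to 0. *)
Lemma diagonal (P : nat -> nat -> R) :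
  (forall m (eta : R), 0 < eta -> \forall n \near within N \oo, 1 - eta <= P m n) ->
  exists mu : nat -> nat, (forall M, \forall n \near within N \oo, (M <= mu n)%N) /\
    forall eta : R, 0 < eta -> \forall n \near within N \oo, 1 - eta <= P (mu n) n.
Proof.
move=> lo; pose A n (m : 'I_n.+1) := 1 - m.+1%:R^-1 <= P m n.
pose mu n := (\max_(m < n.+1 | A n m) m)%N; exists mu.
have main M : \forall n \near within N \oo, (M <= mu n)%N && (1 - M.+1%:R^-1 <= P (mu n) n).
  have e0 : 0 < M.+1%:R^-1 :> R by rewrite invr_gt0.
  near=> n; have nM : (M < n.+1)%N by rewrite ltnS; near: n; exact: near_within_ge.
  have AM : A n (Ordinal nM) by rewrite /A /=; near: n; exact: lo.
  have Mmu : (M <= mu n)%N by exact: (leq_bigmax_cond (F := fun m : 'I_n.+1 => m : nat) _ AM).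
  rewrite Mmu /=; have /(eq_bigmax_cond (fun m : 'I_n.+1 => m : nat))[i Ai muE] : (0 < #|A n|)%N.
    by apply/card_gt0P; exists (Ordinal nM).
  have muE' : mu n = i by rewrite /mu -muE.
  have Ai' : 1 - i.+1%:R^-1 <= P i n by exact: Ai.
  rewrite muE'; apply: le_trans Ai'; rewrite lerD2l lerN2 lef_pV2 ?posrE// ler_nat ltnS -muE'//.
split=> [M|eta eta0].
  by apply: filterS (main M) => n /andP[].
pose M := Num.truncn eta^-1.
apply: filterS (main M) => n /andP[_]; apply: le_trans.
rewrite lerD2l lerN2 -[leRHS]invrK lef_pV2 ?posrE ?invr_gt0//.
exact/ltW/truncnS_gt.
Unshelve. all: by end_near.
Qed.

Lemma near_prob_le1 (alpha : R) (A : forall n, pred {set {set 'I_n}}) : 0 < alpha ->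
  \forall n \near within N \oo,
    random_subset_prob (edges (G n)) (alpha / (d n)%:R) (@A n) <= 1.
Proof.
move=> a0; have := near_asymptotically (asymptotically_degree alpha).
apply: filterS => n ad; have d0 : 0 < (d n)%:R :> R by apply: lt_le_trans ad.
rewrite random_subset_probE -[leRHS](Ex_cst (edges (G n)) (alpha / (d n)%:R)).
apply: le_Ex => [||F _]; rewrite ?lern1 ?leq_b1//; first by rewrite divr_ge0// ltW.
by rewrite ler_pdivrMr// mul1r.
Qed.

End Final.

Theorem theorem1 (R : realType) (alpha : R) (N : set nat) (d : nat -> nat)
    (G : forall n : nat, rel 'I_n)
    (alpha_gt0 : 0 < alpha) (alpha_neq1 : alpha != 1)
    (N_gt0 : forall n, N n -> (0 < n)%N) (N_infinite : infinite_set N)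
    (G_regular : forall n, N n -> regular_graph (G n) (d n))
    (d_infty : d n @[n --> within N \oo] --> \oo)
    (lambda_small : (fun n => lambda R (G n)) =o_ (within N \oo)
                    (fun n => (d n)%:R : R)) :
  (alpha < 1 ->
    exists2 C : R, 0 < C &
      whp N (fun n => random_subset_prob (edges (G n)) (alpha / (d n)%:R)
        (fun F => [forall K in components F, #|K|%:R <= C * ln (n%:R : R)])))
  /\
  (1 < alpha ->
    exists C : R, 0 < C /\
    exists2 eps : nat -> R, eps n @[n --> within N \oo] --> (0 : R) &
      whp N (fun n => random_subset_prob (edges (G n)) (alpha / (d n)%:R)
        (fun F =>
          let m := (1 - conjugate_root alpha / alpha) * n%:R in
          (#|giants F m (eps n)| == 1%N) &&
          [forall K in components F :\: giants F m (eps n),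
             #|K|%:R <= C * ln (n%:R : R)]))).
Proof.
have asym P := @near_asymptotically R N d G N_gt0 G_regular d_infty lambda_small P.
have le1 A := @near_prob_le1 R N d G N_gt0 G_regular d_infty lambda_small alpha A alpha_gt0.
split=> a1.
  have [C C0 main] := subcritical_components alpha_gt0 a1.
  exists C => //; apply: whp_lower => [eta eta0|]; last exact: le1.
  exact: (asym _ (main eta eta0)).
have [q0 q1 qE aq1] := conjugate_rootP a1.
have [C C0 main] := supercritical_components a1 q0 q1 qE aq1.
exists C; split=> //.
(* The shift by two gives [del m <= 1 / 2], as [main] requires. *)
pose del m : R := m.+2%:R^-1.
have del0 m : 0 < del m by rewrite invr_gt0.
have del1 m : del m <= 1 / 2 by rewrite div1r lef_pV2 ?posrE// ler_nat.
have [mu [mu_infty prob]] := diagonal (fun m eta eta0 =>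
  asym _ (main (del m) eta (del0 m) (del1 m) eta0)).
exists (fun n => del (mu n)); last by apply: whp_lower => //; exact: le1.
apply/cvgrPdist_le => eta eta0.
apply: filterS (mu_infty (Num.truncn eta^-1)) => n Mn.
rewrite sub0r normrN gtr0_norm// -[leRHS]invrK lef_pV2 ?posrE ?invr_gt0//.
by apply/ltW/(lt_le_trans (truncnS_gt _)); rewrite ler_nat ltnS leqW.
Qed.
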